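(* Let $\mathcal I$ be a non-trivial ideal in $\mathbb C[[x,y]]$ and $\omega=x^{\nu-1}dx\wedge dy$ with $\nu\in\mathbb N^*$, where $\nu=1$ if $\mathcal I$ is not divisible by $x$. Let $S$ be a compact face of the Newton polygon of $\mathcal I$ with equation $\alpha+q\beta=N$ that hits the $x$-axis (its lower endpoint has $\beta=0$), which is not a dicritical face, and whose face polynomial has exactly one (distinct) root. Then the factor $1-\mathbb L^{-(\nu+q)}T^N$ coming from $S$ does not appear in the denominator of the motivic zeta function $\zeta(\mathcal I,\omega)(T)$, in the sense made precise in the context. The analogous result holds for a face $S$ with equation $p\alpha+\beta=N$ that hits the $y$-axis (its upper endpoint has $\alpha=0$), is not dicritical and whose face polynomial has exactly one root: the factor $1-\mathbb L^{-(p\nu+1)}T^N$ coming from $S$ does not appear in the denominator of $\zeta(\mathcal I,\omega)(T)$.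
   Context: Newton diagram. For $\mathcal I=(f_1,\dots,f_r)$ the Newton diagram $\Delta(\mathcal I)$ is the smallest convex set containing $\bigcup_i\operatorname{Supp}f_i+\mathbb R_+^2$. Let its vertices be $v_i=(\alpha_i,\beta_i)$, $0\le i\le m$, $\alpha_{i-1}<\alpha_i$, $\beta_{i-1}>\beta_i$. Compact faces (forming the Newton polygon) are $S_i=[v_{i-1},v_i]$, with equation $p\alpha+q\beta=N$, $p,q\ge1$ coprime; non-compact faces are the vertical half-line $\alpha=\alpha_0$ ($(p,q)=(1,0)$, $N=\alpha_0$) and the horizontal half-line $\beta=\beta_m$ ($(p,q)=(0,1)$, $N=\beta_m$). For a compact face $S$ on the line $l_S$, $\operatorname{in}(\mathcal I,S)$ is generated by the parts of the $f_i$ supported on $l_S$; it can be written $x^{a_S}y^{b_S}F_{\mathcal I,S}(x^{q},y^{p})\,(k_1(x^{q},y^{p}),\dots,k_s(x^{q},y^{p}))$ with $F_{\mathcal I,S}$ homogeneous, monic in $y$, not divisible by $x$ or $y$ (the face polynomial; its roots are the $\mu\in\mathbb C^*$ with $F_{\mathcal I,S}(1,\mu)=0$), and either $s=1$, $k_1=1$ (then $d_S=0$), or $s\ge2$ and the $k_i$ coprime homogeneous of the same degree $d_S\ge1$. $S$ is dicritical if $d_S\ge1$, i.e. $\operatorname{in}(\mathcal I,S)$ is not principal. Newton maps. For coprime $p,q\ge1$ take $(p',q')\in\mathbb N^2$ with $pp'-qq'=1$, $p'\le q$, $q'<p$; $\sigma_{(p,q,\mu)}(f)(x_1,y_1)=f(\mu^{q'}x_1^p,x_1^q(y_1+\mu^{p'}))$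 for $\mu\in\mathbb C^*$; $\mathcal I_\sigma$ is the ideal generated by $\sigma(\mathcal I)$. Motivic zeta function. $\mathbb L=[\mathbb A^1_{\mathbb C}]$ in the Grothendieck ring $\mathcal G$ of complex varieties. For arcs $\phi=(x(t),y(t))\in(t\mathbb C[[t]])^2$ put $\operatorname{ord}_\phi\mathcal I=\min_{f\in\mathcal I}\operatorname{ord}_t(f\circ\phi)$, $\operatorname{ord}(\omega\circ\phi)=(\nu-1)\operatorname{ord}_tx(t)$ (equal to $0$ if $\nu=1$). A cylinder $\pi_n^{-1}(C)$, with $C$ a constructible set of $n$-jets at the origin, has measure $[C]\mathbb L^{-2n}\in\mathcal G[\mathbb L^{-1}]$. With $V_{n,m}=\{\phi:\operatorname{ord}_\phi\mathcal I=n,\operatorname{ord}(\omega\circ\phi)=m\}$, $\zeta(\mathcal I,\omega)(T)=\sum_{n\ge1}(\sum_{m\ge0}\mu(V_{n,m})\mathbb L^{-m})T^n$; as rational function in $T$ its coefficients are taken in $\mathcal G[\mathbb L^{-1}]$ localized at the elements $1-\mathbb L^{-a}$, $a\in\mathbb Z\setminus\{0\}$. Formula for the zeta function. One has $$\zeta(\mathcal I,\omega)(T)=\sum_{\Delta}\frac{(\mathbb L-1)^2D_\Delta}{(1-\mathbb L^{-(p_1\nu+q_1)}T^{N_1})(1-\mathbb L^{-(p_2\nu+q_2)}T^{N_2})}+\sum_L(\mathbb L-1)(\mathbb L-r-1)\frac{\mathbb L^{-(p\nu+q)}T^N}{1-\mathbb L^{-(p\nu+q)}T^N}+\sum_L\sum_\mu\zeta(\mathcal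 I_{\sigma_{(p,q,\mu)}},\omega_1)(T).$$ Here $L$ runs over the compact faces ($p\alpha+q\beta=N$, with $r$ distinct roots $\mu$ of the face polynomial), $\omega_1=x_1^{p\nu+q-1}dx_1\wedge dy_1$, and $\Delta$ runs over the pairs of consecutive (compact or non-compact) faces, with equations $p_i\alpha+q_i\beta=N_i$, meeting in the vertex $(a,b)$; $D_\Delta=\sum\mathbb L^{-(\nu i+j)}T^{ia+jb}$, the sum being over the $(i,j)\in\mathbb N^2$ of the form $\mu_1(p_1,q_1)+\mu_2(p_2,q_2)$ with $\mu_1,\mu_2\in\mathbb Q\cap(0,1]$. For an ideal generated by $x^{M_1}(y+h(x))^{M_2}$, $h\in x\mathbb C[[x]]$, one has $\zeta=(\mathbb L-1)^2\frac{\mathbb L^{-\nu}T^{M_1}}{1-\mathbb L^{-\nu}T^{M_1}}\cdot\frac{\mathbb L^{-1}T^{M_2}}{1-\mathbb L^{-1}T^{M_2}}$. Iterating, $\zeta(\mathcal I,\omega)(T)$ becomes a finite sum of explicit terms. Meaning of the conclusion. Each denominator factor $1-\mathbb L^{-(p\nu+q)}T^N$ in these terms is attached to a face (compact or non-compact) $p\alpha+q\beta=N$ of an occurring Newton diagram, with $x^{\nu-1}dx\wedge dy$ the form at that stage. The vertical non-compact face of the diagram of $\mathcal I_{\sigma_{(p,q,\mu)}}$ has equation $\alpha=N$, where $p\alpha+q\beta=N$ is the face $S$ defining $\sigma_{(p,q,\mu)}$, and its factor is the same as, and is identified with, the factor attached to $S$. ''The factor coming from $S$ does not appear in the denominator''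 means that it cancels: the sum of all terms containing the factor attached to $S$ can be written as a rational function whose denominator is a product of factors attached to other faces only. (It is allowed that the factor attached to another face happens to be equal, as an expression, to the one attached to $S$.) *)

(* Defs.v *)
From HB Require Import structures.
From mathcomp Require Import all_boot all_order all_algebra.
From mathcomp Require Import generic_quotient.
From mathcomp Require Import boolp classical_sets reals.
From mathcomp Require convex mpoly.
From mathcomp Require Export complex.
Import (canonicals) mpoly.

Set Implicit Arguments.
Unset Strict Implicit.
Unset Printing Implicit Defensive.

Import Order.TTheory GRing.Theory Num.Theory.
Local Open Scope classical_set_scope.
Local Open Scope ring_scope.
Local Open Scope quotient_scope.

Record fps (R : Type) := FPS { coefs : nat -> R }.
HB.instance Definition _ (R : Type) := gen_eqMixin (fps R).
HB.instance Definition _ (R : Type) := gen_choiceMixin (fps R).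

Section PowerSeries.
Variable R : comPzRingType.
Implicit Types f g h : fps R.

Lemma fpsP f g : (forall n, coefs f n = coefs g n) -> f = g.
Proof. by case: f g => [f] [g] /= fg; congr FPS; apply/funext. Qed.

Definition fps_const (c : R) := FPS (fun n => if n == 0%N then c else 0).
Definition fps_var : fps R := FPS (fun n => (n == 1%N)%:R).
Definition fps_add f g := FPS (fun n => coefs f n + coefs g n).
Definition fps_opp f := FPS (fun n => - coefs f n).
Definition fps_mul f g :=
  FPS (fun n => \sum_(i < n.+1) coefs f i * coefs g (n - i)%N).

Fact fps_addA : associative fps_add.
Proof. by move=> f g h; apply: fpsP => n; rewrite /= addrA. Qed.
Fact fps_addC : commutative fps_add.
Proof. by move=> f g; apply: fpsP => n; rewrite /= addrC. Qed.
Fact fps_add0 : left_id (fps_const 0) fps_add.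
Proof. by move=> f; apply: fpsP => n /=; rewrite if_same add0r. Qed.
Fact fps_addN : left_inverse (fps_const 0) fps_opp fps_add.
Proof. by move=> f; apply: fpsP => n /=; rewrite if_same addNr. Qed.

HB.instance Definition _ :=
  GRing.isZmodule.Build (fps R) fps_addA fps_addC fps_add0 fps_addN.

Fact fps_mulC : commutative fps_mul.
Proof.
move=> f g; apply: fpsP => n /=; rewrite (reindex_inj rev_ord_inj) /=.
by apply: eq_bigr => i _; rewrite subSS subKn ?leq_ord// mulrC.
Qed.
Fact fps_mulA : associative fps_mul.
Proof.
move=> f g h; apply: fpsP => n.
pose c3 i j := coefs f i * (coefs g j * coefs h (n - i - j)%N).
transitivity (\sum_(i < n.+1) \sum_(j < n.+1 | (j <= n - i)%N) c3 i j).
  apply: eq_bigr => /= i _; rewrite big_distrr /=.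
  by rewrite (big_ord_narrow_leq (leq_subr _ _)).
pose d3 i j := coefs f i * coefs g (j - i)%N * coefs h (n - j)%N.
transitivity (\sum_(j < n.+1) \sum_(i < n.+1 | (i <= j)%N) d3 i j); last first.
  apply: eq_bigr => /= j _; rewrite big_distrl /=.
  by rewrite (big_ord_narrow_leq (leq_ord _)).
rewrite [RHS](exchange_big_dep predT) //=; apply: eq_bigr => i _.
rewrite (big_ord_narrow_leq (leq_subr i n)) /=.
have -> : \sum_(j < n.+1 | (i <= j)%N) d3 i j = \sum_(i <= j < n.+1) d3 i j.
  by rewrite big_geq_mkord.
rewrite -[X in index_iota X _]add0n big_addn big_mkord subSn ?leq_ord//.
by apply: eq_bigr => j _; rewrite /c3 /d3 addnK mulrA subnDA subnAC.
Qed.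
Fact fps_mul1 : left_id (fps_const 1) fps_mul.
Proof.
move=> f; apply: fpsP => n /=.
by rewrite big_ord_recl /= mul1r subn0 big1 ?addr0// => i _; rewrite mul0r.
Qed.
Fact fps_mulDl : left_distributive fps_mul fps_add.
Proof.
move=> f g h; apply: fpsP => n /=; rewrite -big_split /=.
by apply: eq_bigr => i _; rewrite mulrDl.
Qed.

HB.instance Definition _ := GRing.Zmodule_isComPzRing.Build (fps R)
  fps_mulA fps_mulC fps_mul1 fps_mulDl.

Lemma coefsM f g n :
  coefs (f * g) n = \sum_(i < n.+1) coefs f i * coefs g (n - i)%N.
Proof. by []. Qed.

Lemma coefsB f g n : coefs (f - g) n = coefs f n - coefs g n.
Proof. by []. Qed.

Lemma coefs1 n : coefs (1 : fps R) n = (n == 0%N)%:R.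
Proof. by rewrite /=; case: eqP. Qed.

Lemma coefs_constM c f n : coefs (fps_const c * f) n = c * coefs f n.
Proof.
by rewrite coefsM big_ord_recl /= subn0 big1 ?addr0 // => i _; rewrite mul0r.
Qed.

Lemma coefs_varXM N f n :
  coefs (fps_var ^+ N * f) n = if (N <= n)%N then coefs f (n - N)%N else 0.
Proof.
elim: N n => [|N IH] n; first by rewrite expr0 mul1r subn0.
rewrite exprS -mulrA; move: (_ ^+ N * f) IH => g IH; rewrite coefsM.
case: n => [|n]; first by rewrite big_ord1 mul0r.
rewrite big_ord_recl mul0r add0r big_ord_recl mul1r big1 /= ?addr0.
  by rewrite -[bump 0 0]/1%N subn1 IH subSS.
by move=> i _; rewrite mul0r.
Qed.

Definition is_polynomial f := exists d, forall n, (d <= n)%N -> coefs f n = 0.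

End PowerSeries.

Section Varieties.
Variable K : closedFieldType.

Definition affine n := 'I_n -> K.

Definition zero_locus n (ps : seq (mpoly.mpoly n K)) : set (affine n) :=
  [set v | forall P, P \in ps -> mpoly.meval v P = 0].

Definition locally_closed n (X : set (affine n)) :=
  exists ps qs, X = zero_locus ps `\` zero_locus qs.

Inductive constructible n : set (affine n) -> Prop :=
| constructible_lc X : locally_closed X -> constructible X
| constructibleU X Y :
    constructible X -> constructible Y -> constructible (X `|` Y).

Definition regular_map n m (X : set (affine n)) (f : affine n -> affine m) :=
  forall (i : 'I_m) x, X x -> exists P Q : mpoly.mpoly n K,
    mpoly.meval x Q != 0 /\
    forall y, X y -> mpoly.meval y Q != 0 ->
      f y i = mpoly.meval y P / mpoly.meval y Q.

Definition isomorphic n m (X : set (affine n)) (Y : set (affine m)) :=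
  exists (f : affine n -> affine m) (g : affine m -> affine n),
    [/\ regular_map X f, regular_map Y g,
        forall x, X x -> Y (f x) /\ g (f x) = x &
        forall y, Y y -> X (g y) /\ f (g y) = y].

Definition set_prod n m (X : set (affine n)) (Y : set (affine m)) :
    set (affine (n + m)) :=
  [set v | X (fun i => v (lshift m i)) /\ Y (fun j => v (rshift n j))].

(** The ring is given by generators and relations: [G_expr] are the ring
    expressions in the generators, [G_eq] is the congruence generated by the
    axioms of commutative rings and by the relations.  The generators are the
    classes of constructible subsets of affine spaces (every variety is a finite
    disjoint union of locally closed subsets of affine spaces), an inverse of
    [L], and inverses of [1 - L^-a] for [a >= 1]; as
    [1 - L^a = - L^a (1 - L^-a)], the elements [1 - L^-a] with [a < 0] become
    invertible too. *)
Inductive G_expr :=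
| G_class n (X : set (affine n)) of constructible X
| G_invL
| G_inv of nat
| G_zero
| G_one
| G_opp of G_expr
| G_add of G_expr & G_expr
| G_mul of G_expr & G_expr.

HB.instance Definition _ := gen_eqMixin G_expr.
HB.instance Definition _ := gen_choiceMixin G_expr.

Fixpoint G_exp x n := if n is n'.+1 then G_mul x (G_exp x n') else G_one.

Reserved Notation "x =G y" (at level 70).

Inductive G_eq : G_expr -> G_expr -> Prop :=
| G_refl x : x =G x
| G_sym x y : x =G y -> y =G x
| G_trans x y z : x =G y -> y =G z -> x =G z
| G_oppE x x' : x =G x' -> G_opp x =G G_opp x'
| G_addE x x' y y' : x =G x' -> y =G y' -> G_add x y =G G_add x' y'
| G_mulE x x' y y' : x =G x' -> y =G y' -> G_mul x y =G G_mul x' y'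
| G_addA x y z : G_add x (G_add y z) =G G_add (G_add x y) z
| G_addC x y : G_add x y =G G_add y x
| G_add0 x : G_add G_zero x =G x
| G_addN x : G_add (G_opp x) x =G G_zero
| G_mulA x y z : G_mul x (G_mul y z) =G G_mul (G_mul x y) z
| G_mulC x y : G_mul x y =G G_mul y x
| G_mul1 x : G_mul G_one x =G x
| G_mulD x y z : G_mul (G_add x y) z =G G_add (G_mul x z) (G_mul y z)
| G_iso n m (X : set (affine n)) (Y : set (affine m))
    (cX : constructible X) (cY : constructible Y) :
    locally_closed X -> locally_closed Y -> isomorphic X Y ->
    G_class cX =G G_class cY
| G_scissor n (X Y : set (affine n)) (cX : constructible X)
    (cY : constructible Y) (cXY : constructible (X `|` Y)) :
    X `&` Y = set0 -> G_class cXY =G G_add (G_class cX) (G_class cY)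
| G_product n m (X : set (affine n)) (Y : set (affine m))
    (cX : constructible X) (cY : constructible Y)
    (cXY : constructible (set_prod X Y)) :
    G_class cXY =G G_mul (G_class cX) (G_class cY)
| G_point (c : constructible [set: affine 0]) : G_class c =G G_one
| G_invLE (c : constructible [set: affine 1]) :
    G_mul (G_class c) G_invL =G G_one
| G_invE a : (0 < a)%N ->
    G_mul (G_add G_one (G_opp (G_exp G_invL a))) (G_inv a) =G G_one
where "x =G y" := (G_eq x y).

Definition G_eqb : rel G_expr := fun x y => `[< G_eq x y >].
Fact G_eqb_refl : reflexive G_eqb.
Proof. by move=> x; apply/asboolP/G_refl. Qed.
Fact G_eqb_sym : symmetric G_eqb.
Proof. by move=> x y; apply/asboolP/asboolP => /G_sym. Qed.
Fact G_eqb_trans : transitive G_eqb.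
Proof.
by move=> y x z /asboolP xy /asboolP yz; apply/asboolP/(G_trans xy yz).
Qed.
Canonical G_equiv := EquivRel G_eqb G_eqb_refl G_eqb_sym G_eqb_trans.

Definition motivic := {eq_quot G_eqb}.
HB.instance Definition _ := Choice.on motivic.

Definition G_pi (x : G_expr) : motivic := \pi_motivic x.

Lemma G_piP x y : G_eq x y -> G_pi x = G_pi y.
Proof. by move=> xy; apply/eqmodP/asboolP. Qed.

Lemma G_reprP x : G_eq (repr (G_pi x)) x.
Proof.
have : \pi_motivic (repr (G_pi x)) == \pi_motivic x :> motivic.
  by apply/eqP; exact: reprK.
by rewrite eqmodE => /asboolP.
Qed.

Lemma G_piW (P : motivic -> Prop) : (forall x, P (G_pi x)) -> forall a, P a.
Proof. by move=> Px a; have := Px (repr a); rewrite /G_pi reprK. Qed.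

Definition motivic_add (a b : motivic) := G_pi (G_add (repr a) (repr b)).
Definition motivic_mul (a b : motivic) := G_pi (G_mul (repr a) (repr b)).
Definition motivic_opp (a : motivic) := G_pi (G_opp (repr a)).

Lemma motivic_addE x y : motivic_add (G_pi x) (G_pi y) = G_pi (G_add x y).
Proof. by apply/G_piP/G_addE; exact: G_reprP. Qed.
Lemma motivic_mulE x y : motivic_mul (G_pi x) (G_pi y) = G_pi (G_mul x y).
Proof. by apply/G_piP/G_mulE; exact: G_reprP. Qed.
Lemma motivic_oppE x : motivic_opp (G_pi x) = G_pi (G_opp x).
Proof. by apply/G_piP/G_oppE; exact: G_reprP. Qed.

Fact motivic_addA : associative motivic_add.
Proof.
by do 3![elim/G_piW=> ?]; rewrite !motivic_addE; exact/G_piP/G_addA.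
Qed.
Fact motivic_addC : commutative motivic_add.
Proof.
by do 2![elim/G_piW=> ?]; rewrite !motivic_addE; exact/G_piP/G_addC.
Qed.
Fact motivic_add0 : left_id (G_pi G_zero) motivic_add.
Proof. by elim/G_piW=> x; rewrite motivic_addE; exact/G_piP/G_add0. Qed.
Fact motivic_addN : left_inverse (G_pi G_zero) motivic_opp motivic_add.
Proof.
by elim/G_piW=> x; rewrite motivic_oppE motivic_addE; exact/G_piP/G_addN.
Qed.
HB.instance Definition _ := GRing.isZmodule.Build motivic
  motivic_addA motivic_addC motivic_add0 motivic_addN.

Fact motivic_mulA : associative motivic_mul.
Proof.
by do 3![elim/G_piW=> ?]; rewrite !motivic_mulE; exact/G_piP/G_mulA.
Qed.
Fact motivic_mulC : commutative motivic_mul.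
Proof.
by do 2![elim/G_piW=> ?]; rewrite !motivic_mulE; exact/G_piP/G_mulC.
Qed.
Fact motivic_mul1 : left_id (G_pi G_one) motivic_mul.
Proof. by elim/G_piW=> x; rewrite motivic_mulE; exact/G_piP/G_mul1. Qed.
Fact motivic_mulDl : left_distributive motivic_mul motivic_add.
Proof.
do 3![elim/G_piW=> ?]; rewrite !(motivic_mulE, motivic_addE).
exact/G_piP/G_mulD.
Qed.
HB.instance Definition _ := GRing.Zmodule_isComPzRing.Build motivic
  motivic_mulA motivic_mulC motivic_mul1 motivic_mulDl.

(** Only meaningful for constructible [X]; junk value 0 otherwise. *)
Definition motivic_class n (X : set (affine n)) : motivic :=
  if pselect (constructible X) is left c then G_pi (G_class c) else 0.

Definition Lef : motivic := motivic_class [set: affine 1].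
Definition Linv : motivic := G_pi G_invL.

Lemma constructible_setT n : constructible [set: affine n].
Proof.
apply: constructible_lc; exists [::], [:: 1]; apply/seteqP; split=> v //= _.
split=> // /(_ 1 (mem_head _ _)) /eqP; rewrite mpoly.meval1.
by rewrite oner_eq0.
Qed.

Lemma Lef_inv : Lef * Linv = 1.
Proof.
rewrite /Lef /motivic_class; case: pselect => [c|/(_ (constructible_setT _))//].
by rewrite [LHS]motivic_mulE; apply/G_piP/G_invLE.
Qed.

(** The factor [1 - L^-k T^N], and its inverse among the power series in [T]
    (for [k > 0]). *)
Definition factor (k N : nat) : fps motivic :=
  1 - fps_const (Linv ^+ k) * fps_var motivic ^+ N.

Definition factor_inv (k N : nat) : fps motivic :=
  if N == 0%N then fps_const (G_pi (G_inv k))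
  else FPS (fun n => if (N %| n)%N then Linv ^+ (k * (n %/ N)) else 0).

Lemma factorK (k N : nat) : (0 < k)%N -> factor k N * factor_inv k N = 1.
Proof.
move=> k0; rewrite /factor /factor_inv mulrBl mul1r -mulrA.
apply: fpsP => n; rewrite coefsB coefs_constM coefs_varXM coefs1.
case: (posnP N) => [->|N0].
  case: n => [|n] /=; last by rewrite mulr0 subr0.
  have expE x m : G_pi (G_exp x m) = G_pi x ^+ m.
    by elim: m => // m IH; rewrite exprS -IH; symmetry; exact: motivic_mulE.
  have E : (1 - Linv ^+ k) * G_pi (G_inv k) = 1.
    have := G_piP (G_invE k0).
    by rewrite -motivic_mulE -motivic_addE -motivic_oppE expE.
  by rewrite /= mulrBl mul1r in E.
rewrite /=; case: leqP => [Nn|nN]; last first.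
  rewrite mulr0 subr0; case: n nN => [|n] nN.
    by rewrite dvdn0 div0n muln0 expr0.
  by rewrite gtnNdvd.
rewrite dvdn_subl //; case: n Nn => [|n] Nn.
  by move: N0; rewrite lt0n -leqn0 Nn.
case: ifP => [dn|_]; last by rewrite mulr0 subr0.
rewrite -exprD divnBr // divnn N0.
have : (0 < n.+1 %/ N)%N by rewrite divn_gt0.
by case: (_ %/ _)%N => // m _; rewrite subn1 -mulnS subrr.
Qed.

End Varieties.

Record face := Face { fp : nat; fq : nat; fN : nat }.
HB.instance Definition _ := gen_eqMixin face.
HB.instance Definition _ := gen_choiceMixin face.

Section Newton.
Variable R : realType.
Local Notation C := R[i].

(** [C[[x,y]]] as [C[[x]][[y]]]: the outer variable is [y]. *)
Definition series2 := fps (fps C).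
HB.instance Definition _ := GRing.ComPzRing.on series2.
Definition coef2 (f : series2) (al be : nat) : C := coefs (coefs f be) al.

Definition xx : series2 := fps_const (fps_var C).
Definition yy : series2 := fps_var (fps C).
Definition cst2 (c : C) : series2 := fps_const (fps_const c).
Definition in_x (h : fps C) : series2 := fps_const h.

(** The substitutions [f(X, Y)], for [X] and [Y] without constant term; then
    [X^i Y^j] has order at least [i + j], so that only finitely many terms
    contribute to each coefficient. *)
Definition subst2 (f X Y : series2) : series2 :=
  FPS (fun be => FPS (fun al =>
    \sum_(i < (al + be).+1) \sum_(j < (al + be).+1)
      coef2 f i j * coef2 (X ^+ i * Y ^+ j) al be)).

Definition subst_arc (f : series2) (X Y : fps C) : fps C :=
  FPS (fun n => \sum_(i < n.+1) \sum_(j < n.+1)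
    coef2 f i j * coefs (X ^+ i * Y ^+ j) n).

(** An ideal is represented by a finite sequence of generators. *)
Definition ideal (I : seq series2) : set series2 :=
  [set f | exists c : nat -> series2, f = \sum_(i < size I) c i * nth 0 I i].

Definition nontrivial (I : seq series2) := ideal I <> [set 0] /\ ~ ideal I 1.

Definition divides (f g : series2) := exists h, g = f * h.

Definition x_divides (I : seq series2) := forall f, ideal I f -> divides xx f.

Definition plane : lmodType R := (R^o * R^o)%type.

Definition newton_diagram (I : seq series2) : set plane :=
  smallest (@convex.convex_set R plane)
    [set z | exists f al be, [/\ f \in I, coef2 f al be != 0,
                                 al%:R <= z.1 & be%:R <= z.2]].

(** The face of equation [p alpha + q beta = N]; it is compact iff
    [p, q >= 1]. *)
Definition face_set (I : seq series2) (S : face) : set plane :=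
  [set z | newton_diagram I z /\
           (fp S)%:R * z.1 + (fq S)%:R * z.2 = (fN S)%:R].

Definition is_face (I : seq series2) (S : face) :=
  [/\ coprime (fp S) (fq S),
      forall z, newton_diagram I z ->
        (fN S)%:R <= (fp S)%:R * z.1 + (fq S)%:R * z.2 &
      exists z w, [/\ z <> w, face_set I S z & face_set I S w]].

Definition compact_face (I : seq series2) (S : face) :=
  [/\ is_face I S, (0 < fp S)%N & (0 < fq S)%N].

(** The faces [S1] (on the left) and [S2] (on the right) meet in the vertex
    [(a, b)]. *)
Definition consecutive (I : seq series2) (S1 S2 : face) (a b : nat) :=
  [/\ is_face I S1, is_face I S2, (fp S2 * fq S1 < fp S1 * fq S2)%N,
      face_set I S1 (a%:R, b%:R) & face_set I S2 (a%:R, b%:R)].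

(** As the diagram lies in the first quadrant, a compact face contains a point
    of the [x]-axis ([y]-axis) iff this is its lower (upper) endpoint. *)
Definition hits_x_axis (I : seq series2) (S : face) :=
  exists z, face_set I S z /\ z.2 = 0.
Definition hits_y_axis (I : seq series2) (S : face) :=
  exists z, face_set I S z /\ z.1 = 0.

Definition part (S : face) (f : series2) : series2 :=
  FPS (fun be => FPS (fun al =>
    if (fp S * al + fq S * be == fN S)%N then coef2 f al be else 0)).

Definition initial_ideal (I : seq series2) (S : face) := [seq part S f | f <- I].

Definition homogeneous (d : nat) (F : series2) :=
  forall al be, (al + be != d)%N -> coef2 F al be = 0.

(** For homogeneous polynomials this is coprimality in [C[x,y]]: the initial
    form of a common divisor in [C[[x,y]]] is a common divisor as well. *)
Definition coprime_seq (ks : seq series2) :=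
  forall g, (forall k, k \in ks -> divides g k) -> divides g 1.

Definition face_decomposition (I : seq series2) (S : face)
    (a b e : nat) (F : series2) (d : nat) (ks : seq series2) :=
  [/\ [/\ homogeneous e F, coef2 F 0 e = 1, ~ divides xx F & ~ divides yy F],
      (ks = [:: 1] /\ d = 0%N) \/
      [/\ (2 <= size ks)%N, (1 <= d)%N,
          forall k, k \in ks -> homogeneous d k & coprime_seq ks] &
      ideal (initial_ideal I S) =
      ideal [seq xx ^+ a * yy ^+ b *
                 subst2 F (xx ^+ fq S) (yy ^+ fp S) *
                 subst2 k (xx ^+ fq S) (yy ^+ fp S) | k <- ks]].

Definition dicritical (I : seq series2) (S : face) :=
  exists a b e F d ks, face_decomposition I S a b e F d ks /\ (1 <= d)%N.

Definition face_polynomial (I : seq series2) (S : face) (e : nat) (F : series2) :=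
  exists a b d ks, face_decomposition I S a b e F d ks.

(** [mu] is a nonzero root of [F(1, Y)], for [F] homogeneous of degree [e]. *)
Definition is_root (e : nat) (F : series2) (mu : C) :=
  mu != 0 /\ \sum_(be < e.+1) coef2 F (e - be)%N be * mu ^+ be = 0.

Definition face_root (I : seq series2) (S : face) (mu : C) :=
  exists e F, face_polynomial I S e F /\ is_root e F mu.

Definition root_number (I : seq series2) (S : face) (r : nat) :=
  exists e F (s : seq C), [/\ face_polynomial I S e F, uniq s, size s = r &
                              forall mu, mu \in s <-> is_root e F mu].

Definition newton_exponents (p q p' q' : nat) :=
  [/\ (p * p' = 1 + q * q')%N, (p' <= q)%N & (q' < p)%N].

Definition newton_map (p q p' q' : nat) (mu : C) (f : series2) : series2 :=
  subst2 f (cst2 (mu ^+ q') * xx ^+ p) (xx ^+ q * (yy + cst2 (mu ^+ p'))).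

(** The ideals to which the closed formula for the zeta function applies. *)
Definition base_ideal (I : seq series2) (M1 M2 : nat) :=
  exists h : fps C,
    coefs h 0 = 0 /\ ideal I = ideal [:: xx ^+ M1 * (yy + in_x h) ^+ M2].

Definition arc := (fps C * fps C)%type.
Definition arcs : set arc := [set phi | coefs phi.1 0 = 0 /\ coefs phi.2 0 = 0].

(** The space of [k]-jets at the origin is the affine space of the coefficients
    of [t, ..., t^k] in [x(t)] and [y(t)]. *)
Definition jet (k : nat) (phi : arc) : affine C (k + k) :=
  fun i => match split i with
           | inl j => coefs phi.1 j.+1
           | inr j => coefs phi.2 j.+1
           end.

(** The value does not depend on the representation of the cylinder. *)
Definition cylinder_measure (V : set arc) : motivic C :=
  xget 0 [set c | exists k (X : set (affine C (k + k))),
    [/\ constructible X, V = [set phi | arcs phi /\ X (jet phi)] &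
        c = motivic_class X * Linv C ^+ (2 * k)]].

Definition ord_ideal (I : seq series2) (phi : arc) (n : nat) :=
  (forall f m, ideal I f -> (m < n)%N -> coefs (subst_arc f phi.1 phi.2) m = 0) /\
  (exists2 f, ideal I f & coefs (subst_arc f phi.1 phi.2) n != 0).

Definition ord_form (nu : nat) (phi : arc) (m : nat) :=
  if nu == 1%N then m = 0%N
  else exists e, [/\ forall i, (i < e)%N -> coefs phi.1 i = 0,
                     coefs phi.1 e != 0 & m = (nu.-1 * e)%N].

Definition contact_locus (I : seq series2) (nu n m : nat) : set arc :=
  [set phi | [/\ arcs phi, ord_ideal I phi n & ord_form nu phi m]].

(** The sum over [m] is finite: if [nu > 1] then [I] is divisible by [x], so
    that [ord x(t) <= n] and [m <= (nu - 1) n] on a nonempty contact locus. *)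
Definition zeta (I : seq series2) (nu : nat) : fps (motivic C) :=
  FPS (fun n => if n == 0%N then 0 else
    \sum_(m < (nu.-1 * n).+1)
      cylinder_measure (contact_locus I nu n m) * Linv C ^+ m).

(** A stage of the iteration is given by the sequence of the faces and roots that
    define the Newton maps leading to it, the most recent one coming first. *)
Definition stage_path := seq (face * C).

(** Faces of occurring Newton diagrams, the vertical non-compact face at a stage
    other than the first one being identified with the face that defines the
    last Newton map. *)
Definition label := (stage_path * face)%type.

Definition face_label (pi : stage_path) (S : face) : label :=
  if pi is (S', _) :: pi' then
    if (fp S == 1%N) && (fq S == 0%N) then (pi', S') else (pi, S)
  else (pi, S).

(** [(l, (k, N))] is the factor [1 - L^-k T^N], attached to [l]. *)
Definition den_factor := (label * (nat * nat))%type.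

Definition face_factor (pi : stage_path) (nu : nat) (S : face) : den_factor :=
  (face_label pi S, ((fp S * nu + fq S)%N, fN S)).

(** The three kinds of terms: for a pair of consecutive faces meeting in a
    vertex, for a compact face with [r] roots, and for a base ideal. *)
Inductive zeta_term :=
| VertexTerm (pi : stage_path) (nu : nat) (S1 S2 : face) (a b : nat)
| FaceTerm (pi : stage_path) (nu : nat) (S : face) (r : nat)
| BaseTerm (pi : stage_path) (nu M1 M2 : nat).
HB.instance Definition _ := gen_eqMixin zeta_term.

Local Notation Lc c := (fps_const (c : motivic C)).
Local Notation LL := (Lef C).
Local Notation LV := (Linv C).
Local Notation T := (fps_var (motivic C)).

Definition in_parallelogram (S1 S2 : face) (i j : nat) : Prop :=
  exists m1 m2 : rat, [/\ 0 < m1 <= 1, 0 < m2 <= 1,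
    i%:R = m1 * (fp S1)%:R + m2 * (fp S2)%:R &
    j%:R = m1 * (fq S1)%:R + m2 * (fq S2)%:R].

Definition vertex_sum (nu : nat) (S1 S2 : face) (a b : nat) : fps (motivic C) :=
  \sum_(i < (fp S1 + fp S2).+1) \sum_(j < (fq S1 + fq S2).+1
      | `[< in_parallelogram S1 S2 i j >])
    Lc (LV ^+ (nu * i + j)) * T ^+ (i * a + j * b).

Definition numerator (t : zeta_term) : fps (motivic C) :=
  match t with
  | VertexTerm _ nu S1 S2 a b => Lc ((LL - 1) ^+ 2) * vertex_sum nu S1 S2 a b
  | FaceTerm _ nu S1 r =>
      Lc ((LL - 1) * (LL - r%:R - 1)) *
      (Lc (LV ^+ (fp S1 * nu + fq S1)) * T ^+ fN S1)
  | BaseTerm _ nu M1 M2 =>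
      Lc ((LL - 1) ^+ 2) * (Lc (LV ^+ nu) * T ^+ M1) * (Lc LV * T ^+ M2)
  end.

Definition denominator (t : zeta_term) : seq den_factor :=
  match t with
  | VertexTerm pi nu S1 S2 _ _ => [:: face_factor pi nu S1; face_factor pi nu S2]
  | FaceTerm pi nu S1 _ => [:: face_factor pi nu S1]
  | BaseTerm pi nu M1 M2 =>
      [:: face_factor pi nu (Face 1 0 M1); face_factor pi nu (Face 0 1 M2)]
  end.

Definition value (t : zeta_term) : fps (motivic C) :=
  numerator t * \prod_(f <- denominator t) factor_inv C f.2.1 f.2.2.

(** The general formula is applied to the initial ideal, and then to every ideal
    obtained that is not a base ideal. *)
Definition expanded (pi : stage_path) (I : seq series2) :=
  pi = [::] \/ ~ exists M1 M2, base_ideal I M1 M2.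

Section Iteration.
Variables (I0 : seq series2) (nu0 : nat).

Inductive stage : stage_path -> seq series2 -> nat -> Prop :=
| stage_init : stage [::] I0 nu0
| stage_next pi I nu S mu p' q' :
    stage pi I nu -> expanded pi I -> compact_face I S -> face_root I S mu ->
    newton_exponents (fp S) (fq S) p' q' ->
    stage ((S, mu) :: pi)
          [seq newton_map (fp S) (fq S) p' q' mu f | f <- I]
          (fp S * nu + fq S).

Inductive occurs : zeta_term -> Prop :=
| occurs_vertex pi I nu S1 S2 a b :
    stage pi I nu -> expanded pi I -> consecutive I S1 S2 a b ->
    occurs (VertexTerm pi nu S1 S2 a b)
| occurs_face pi I nu S r :
    stage pi I nu -> expanded pi I -> compact_face I S -> root_number I S r ->
    occurs (FaceTerm pi nu S r)
| occurs_base pi I nu M1 M2 :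
    stage pi I nu -> ~ expanded pi I -> base_ideal I M1 M2 ->
    occurs (BaseTerm pi nu M1 M2).

Definition contains_factor_of (S : face) (t : zeta_term) :=
  ([::], S) \in [seq f.1 | f <- denominator t].

Definition enumerates (ts : seq zeta_term) (P : zeta_term -> Prop) :=
  uniq ts /\ forall t, t \in ts <-> P t.

(** [Z] is a rational function in [T] whose denominator is a product of factors
    attached to faces other than the face [S] of the diagram of [I0].  All the
    factors are invertible power series in [T]. *)
Definition denominator_avoids (S : face) (Z : fps (motivic C)) :=
  exists (fs : seq den_factor) (P : fps (motivic C)),
    [/\ forall f, f \in fs ->
          f.1 <> ([::], S) /\ exists t, occurs t /\ f \in denominator t,
        is_polynomial P &
        Z * \prod_(f <- fs) factor C f.2.1 f.2.2 = P].

(** The second part is the consequence for the zeta function itself, whenever it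
    is the sum of the finitely many terms of the iterated formula. *)
Definition factor_does_not_appear (S : face) :=
  (exists ts, enumerates ts (fun t => occurs t /\ contains_factor_of S t) /\
     denominator_avoids S (\sum_(t <- ts) value t)) /\
  (forall ts, enumerates ts occurs -> zeta I0 nu0 = \sum_(t <- ts) value t ->
     denominator_avoids S (zeta I0 nu0)).

End Iteration.
End Newton.

(* Main.v *)
Require Import Defs.
From mathcomp Require Import all_boot all_order all_algebra reals.
From mathcomp Require Import boolp classical_sets.
From mathcomp Require convex.
From mathcomp Require Import ring lra zify.

(** Let [S] be the given face, with primitive vector [u]. The factor of [S] occurs
    in the terms of the two vertices of [S], in the term of [S] itself and, after
    the Newton map at the unique root, in the term of the vertex at the end of the
    vertical face. A vertex term is [(L - 1)^2] times the generating series of the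
    lattice points of an open cone. The vertex of [S] on the coordinate axis and
    the term of [S] add up to [(L - 1)^2 X / (1 - X)], where [1 - X] is the factor of
    [S]: the generating series of the ray spanned by [u]. As [S] is not dicritical
    and has one root, the vertical face of the transformed diagram ends at the
    vertex [(N, e)], where [e] is the degree of the face polynomial, and a linear
    change of lattice coordinates turns the corresponding cone into one which is
    adjacent to the ray on the side opposite to the cone of the other vertex of
    [S]. The two cones and the ray form a single cone, whose generating series no
    longer involves the factor of [S]. For a face that hits the [y]-axis this needs
    [nu = 1], which holds because [I] is not divisible by [x]. *)

Set Implicit Arguments.
Unset Strict Implicit.
Unset Printing Implicit Defensive.

Import Order.TTheory GRing.Theory Num.Theory.
Local Open Scope ring_scope.

(** * Generating series of lattice cones *)

(** The decomposition of the cone cannot be summed directly in the ring of values: the monomials A =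
    L^-nu T^a and B = L^-1 T^b of a vertex (a, b) may be free of T, and then the cone series has no
    T-adic limit; nor is there a cancellation law in the motivic ring. The decomposition is
    therefore proved for power series over the integers, multiplied by the three factors until only
    polynomials remain, and then evaluated at A and B; after that only the given inverses of the
    factors are used. The same A and B serve for both diagrams, because the corner (N, e) of the
    transformed diagram has the monomials U and L^-1 T^e, where 1 - U is the factor of S. On the
    x-axis U = A B^q, which the shear (i, j) -> (i, q i + j) absorbs. On the y-axis the coordinates
    are exchanged, which respects the weights only if x and y both weigh L^-1; the same condition nu
    = 1 lets the factor 1 - L^-nu of the axis cancel against L - 1. *)

Section DoubleSeries.
Variable K : comPzRingType.
Implicit Types f g : fps (fps K).

Definition dcoef f (i j : nat) : K := coefs (coefs f j) i.

Definition dmonom (i j : nat) : fps (fps K) :=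
  fps_const (fps_var K ^+ i) * fps_var (fps K) ^+ j.

Lemma dcoefP f g : (forall i j, dcoef f i j = dcoef g i j) -> f = g.
Proof. by move=> fg; apply: fpsP => j; apply: fpsP => i; apply: fg. Qed.

Lemma coefs_sum (L : comPzRingType) (T : Type) (r : seq T) (P : pred T)
    (F : T -> fps L) n :
  coefs (\sum_(i <- r | P i) F i) n = \sum_(i <- r | P i) coefs (F i) n.
Proof.
elim/big_rec2: _ => [|i y1 y2 _ <-] //=.
by rewrite if_same.
Qed.

Lemma dcoef0 i j : dcoef 0 i j = 0.
Proof. by rewrite /dcoef /= if_same /= if_same. Qed.

Lemma dcoefD f g i j : dcoef (f + g) i j = dcoef f i j + dcoef g i j.
Proof. by []. Qed.

Lemma dcoefB f g i j : dcoef (f - g) i j = dcoef f i j - dcoef g i j.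
Proof. by []. Qed.

Lemma dcoef_sum (T : Type) (r : seq T) (P : pred T) (F : T -> fps (fps K)) i j :
  dcoef (\sum_(k <- r | P k) F k) i j = \sum_(k <- r | P k) dcoef (F k) i j.
Proof. by rewrite /dcoef !coefs_sum. Qed.

Lemma dcoefM f g i j :
  dcoef (f * g) i j = \sum_(l < j.+1) \sum_(k < i.+1)
    dcoef f k l * dcoef g (i - k) (j - l).
Proof. by rewrite /dcoef coefsM coefs_sum. Qed.

Lemma dcoef_dmonomM k l f i j :
  dcoef (dmonom k l * f) i j =
  if (k <= i)%N && (l <= j)%N then dcoef f (i - k) (j - l) else 0.
Proof.
rewrite /dcoef /dmonom -mulrA coefs_constM coefs_varXM coefs_varXM.
by case: leqP => // _; case: leqP => //= _; rewrite if_same.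
Qed.

Lemma dcoef_dmonom k l i j : dcoef (dmonom k l) i j = ((i == k) && (j == l))%:R.
Proof.
rewrite -[dmonom k l]mulr1 dcoef_dmonomM.
case: leqP => [ki|ik] /=; last by rewrite ltn_eqF.
case: leqP => [lj|jl] /=; last by rewrite [j == l]ltn_eqF ?andbF.
have dcoef1 m n : dcoef (1 : fps (fps K)) m n = ((m == 0%N) && (n == 0%N))%:R.
  rewrite /dcoef /=; case: (n == 0%N) => /=; last by rewrite if_same andbF.
  by rewrite andbT; case: (m == 0%N).
by rewrite dcoef1 !subn_eq0 ![_ == k]eqn_leq ![_ == l]eqn_leq ki lj !andbT.
Qed.

End DoubleSeries.

(* Determinant conditions: all divisions in [in_parallelogram] are cleared. *)
Definition in_cone (v1 v2 w1 w2 i j : nat) : bool :=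
  (v2 * i < v1 * j)%N && (w1 * j < w2 * i)%N.

Definition in_pgram (v1 v2 w1 w2 i j : nat) : bool :=
  [&& in_cone v1 v2 w1 w2 i j,
      (v1 * j + v2 * w1 <= v2 * i + v1 * w2)%N &
      (w2 * i + v2 * w1 <= w1 * j + v1 * w2)%N].

Definition pgram_sum (M : comPzRingType) (A B : M) (v1 v2 w1 w2 : nat) : M :=
  \sum_(i < (v1 + w1).+1) \sum_(j < (v2 + w2).+1 | in_pgram v1 v2 w1 w2 i j)
    A ^+ i * B ^+ j.

(** Cramer's rule without division: [d] is the determinant of v and w, and a/d, b/d are the
    coordinates of (i, j) along v and w. The additive form avoids truncated subtraction. In these
    terms [in_cone] says a, b > 0, and [in_pgram] adds a, b <= d. *)
Lemma cramer (v1 v2 w1 w2 i j : nat) : (v2 * w1 < v1 * w2)%N ->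
  in_cone v1 v2 w1 w2 i j -> exists a b d : nat,
  [/\ (0 < d)%N, (d + v2 * w1 = v1 * w2)%N,
      (a + w1 * j = w2 * i)%N /\ (b + v2 * i = v1 * j)%N &
      (d * i = a * v1 + b * w1)%N /\ (d * j = a * v2 + b * w2)%N].
Proof.
move=> d0 /andP[b0 a0].
exists (w2 * i - w1 * j)%N, (v1 * j - v2 * i)%N, (v1 * w2 - v2 * w1)%N.
have ed := subnK (ltnW d0); have ea := subnK (ltnW a0); have eb := subnK (ltnW b0).
move: (v1 * w2 - _)%N ed (w2 * i - _)%N ea (v1 * j - _)%N eb => d ed a ea b eb.
have := congr1 (muln i) ed; have := congr1 (muln j) ed.
have := congr1 (muln v1) ea; have := congr1 (muln v2) ea.
have := congr1 (muln w1) eb; have := congr1 (muln w2) eb.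
rewrite !mulnDr => ? ? ? ? ? ?.
by split; [lia|lia|split; lia|split; lia].
Qed.

Lemma in_pgram_bound (v1 v2 w1 w2 i j : nat) : (v2 * w1 < v1 * w2)%N ->
  in_pgram v1 v2 w1 w2 i j -> (i <= v1 + w1)%N /\ (j <= v2 + w2)%N.
Proof.
move=> d0 /and3P[ic bd ad].
have [a [b [d [d_gt0 ed [ea eb] [ei ej]]]]] := cramer d0 ic.
have ad' : (a <= d)%N by lia.
have bd' : (b <= d)%N by lia.
rewrite -(leq_pmul2l d_gt0) -[(j <= _)%N](leq_pmul2l d_gt0) ei ej !mulnDr.
by split; apply: leq_add; rewrite leq_mul2r ?ad' ?bd' orbT.
Qed.

Section ConeSeries.
Local Notation K := (fps (fps int)).

Definition cone_series (v1 v2 w1 w2 : nat) : K :=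
  FPS (fun j => FPS (fun i => (in_cone v1 v2 w1 w2 i j)%:R)).

Definition pgram_poly (v1 v2 w1 w2 : nat) : K :=
  FPS (fun j => FPS (fun i => (in_pgram v1 v2 w1 w2 i j)%:R)).

Definition ray_series (u1 u2 : nat) : K :=
  FPS (fun j => FPS (fun i => ((u2 * i == u1 * j)%N && (0 < i + j)%N)%:R)).

(** Multiplying by one minus the monomial of w subtracts the translate of the open cone by w and
    leaves the strip [st] where 0 < b <= d; one minus the monomial of v then cuts the strip down to
    0 < a <= d. *)
Lemma cone_seriesM (v1 v2 w1 w2 : nat) : (v2 * w1 < v1 * w2)%N ->
  (1 - dmonom _ v1 v2) * ((1 - dmonom _ w1 w2) * cone_series v1 v2 w1 w2) =
  pgram_poly v1 v2 w1 w2.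
Proof.
move=> d0; set st : K := FPS (fun j => FPS (fun i =>
  (in_cone v1 v2 w1 w2 i j && (v1 * j + v2 * w1 <= v2 * i + v1 * w2)%N)%:R)).
have -> : (1 - dmonom _ w1 w2) * cone_series v1 v2 w1 w2 = st.
  apply: dcoefP => i j; rewrite mulrBl mul1r dcoefB dcoef_dmonomM /dcoef /=.
  case: ifP => [/andP[]|].
    move=> /subnK <- /subnK <-; move: (i - w1)%N (j - w2)%N => k l.
    rewrite !addnK /in_cone.
    have -> : (w1 * (l + w2) < w2 * (k + w1))%N = (w1 * l < w2 * k)%N by lia.
    have -> : (v1 * (l + w2) + v2 * w1 <= v2 * (k + w1) + v1 * w2)%N
              = (v1 * l <= v2 * k)%N by lia.
    case: (leqP (v1 * l)) => [lt|lt]; first by rewrite andbT subr0.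
    have -> : (v2 * (k + w1) < v1 * (l + w2))%N by lia.
    by rewrite subrr andbF.
  (* Here the translate has no term: (i, j) does not dominate w. A cone point outside the strip has
     b >= d, so (a v + b w)/d would dominate w. *)
  move=> H; rewrite subr0; congr ((_ : bool)%:R).
  case: leqP => [|bd]; first by rewrite andbT.
  rewrite andbF; apply/negbTE/negP => ic.
have [a [b [d [d_gt0 ed [ea eb] [ei ej]]]]] := cramer d0 ic.
have bd' : (d <= b)%N by lia.
move/negP: H; apply; rewrite -(leq_pmul2l d_gt0) -[(w2 <= _)%N](leq_pmul2l d_gt0).
  have ? : (d * w1 <= b * w1)%N by rewrite leq_mul2r bd' orbT.
  have ? : (d * w2 <= b * w2)%N by rewrite leq_mul2r bd' orbT.
  by rewrite ei ej; apply/andP; split; lia.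
apply: dcoefP => i j; rewrite mulrBl mul1r dcoefB dcoef_dmonomM /dcoef /=.
rewrite /in_pgram; case: ifP => [/andP[]|].
  move=> /subnK <- /subnK <-; move: (i - v1)%N (j - v2)%N => k l.
  rewrite !addnK /in_cone.
  have -> : (v2 * (k + v1) < v1 * (l + v2))%N = (v2 * k < v1 * l)%N by lia.
  have -> : (w2 * (k + v1) + v2 * w1 <= w1 * (l + v2) + v1 * w2)%N
            = (w2 * k <= w1 * l)%N by lia.
  have -> : (v1 * (l + v2) + v2 * w1 <= v2 * (k + v1) + v1 * w2)%N
            = (v1 * l + v2 * w1 <= v2 * k + v1 * w2)%N by lia.
  case: (leqP (w2 * k)) => [lt|lt]; first by rewrite !andbT andbF subr0.
  have -> : (w1 * (l + v2) < w2 * (k + v1))%N by lia.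
  by rewrite !andbT !andbF subrr.
move=> H; rewrite subr0; congr ((_ : bool)%:R).
case: (leqP (w2 * i + _)) => [|ad]; first by rewrite andbT.
rewrite !andbF; apply/negbTE/negP => /andP[ic _].
have [a [b [d [d_gt0 ed [ea eb] [ei ej]]]]] := cramer d0 ic.
have ad' : (d <= a)%N by lia.
move/negP: H; apply; rewrite -(leq_pmul2l d_gt0) -[(v2 <= _)%N](leq_pmul2l d_gt0).
have ? : (d * v1 <= a * v1)%N by rewrite leq_mul2r ad' orbT.
have ? : (d * v2 <= a * v2)%N by rewrite leq_mul2r ad' orbT.
by rewrite ei ej; apply/andP; split; lia.
Qed.

(** As u is primitive, the lattice points of its ray other than the origin are the multiples k u
    with k >= 1, and the series is geometric. *)
Lemma ray_seriesM (u1 u2 : nat) : coprime u1 u2 ->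
  (1 - dmonom _ u1 u2) * ray_series u1 u2 = dmonom _ u1 u2.
Proof.
move=> cu.
have u0 : (0 < u1 + u2)%N by case: u1 u2 cu => [|?] [|?].
apply: dcoefP => i j; rewrite mulrBl mul1r dcoefB dcoef_dmonomM dcoef_dmonom.
rewrite /dcoef /=; case: ifP => [/andP[]|].
  move=> /subnK <- /subnK <-; move: (i - u1)%N (j - u2)%N => k l.
  rewrite !addnK.
  have -> : (k + u1 == u1)%N = (k == 0%N) by lia.
  have -> : (l + u2 == u2)%N = (l == 0%N) by lia.
  have -> : (u2 * (k + u1) == u1 * (l + u2))%N = (u2 * k == u1 * l)%N by lia.
  rewrite addnACA [(0 < _ + (u1 + u2))%N]addn_gt0 u0 orbT andbT.
  case: (posnP (k + l)) => [/eqP|kl].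
    by rewrite addn_eq0 => /andP[/eqP-> /eqP->]; rewrite !muln0 eqxx subr0.
  rewrite andbT subrr; case: eqP => [k0|] //; case: eqP => [l0|] //.
  by rewrite k0 l0 in kl.
move=> H; have -> : (i == u1) && (j == u2) = false.
  by apply/negP => /andP[/eqP ei /eqP ej]; rewrite ei ej !leqnn in H.
rewrite subr0; case: eqP => //= e; case: posnP => //= p; exfalso.
move/negP: H; apply.
have d2 : (u1 %| i)%N by rewrite -(Gauss_dvdr _ cu) e dvdn_mulr.
have /dvdnP[k ek] := d2; move: e; rewrite {}ek in p *; move=> e.
case: (posnP u1) => [z|u1p].
  move: cu; rewrite z /coprime gcd0n => /eqP u2e.
  by move: p; rewrite z u2e muln0 /=; lia.
have ej : j = (k * u2)%N by apply/eqP; rewrite -(eqn_pmul2l u1p) -e; apply/eqP; lia.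
by move: p; rewrite ej; case: k {e ej d2} => [|k] //; rewrite !mulSn !leq_addr.
Qed.

(** The sign of u1 * j - u2 * i tells on which side of the ray of u a point lies; the hypotheses put
    that ray strictly inside the cone of v and w. *)
Lemma cone_series_split (v1 v2 u1 u2 w1 w2 : nat) :
  (v2 * u1 < v1 * u2)%N -> (u2 * w1 < u1 * w2)%N ->
  cone_series v1 v2 w1 w2 =
  cone_series v1 v2 u1 u2 + ray_series u1 u2 + cone_series u1 u2 w1 w2.
Proof.
move=> vu uw; apply: dcoefP => i j; rewrite !dcoefD /dcoef /= /in_cone.
have v1p : (0 < v1)%N by case: v1 vu.
have u1p : (0 < u1)%N by case: u1 uw vu => //; lia.
have u2p : (0 < u2)%N by case: u2 vu uw => //; lia.
have w2p : (0 < w2)%N by case: w2 uw; lia.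
have [zu|uz|zu] := ltngtP (u2 * i) (u1 * j).
- have -> : (v2 * i < v1 * j)%N by nia.
  by rewrite !add0r.
- have -> : (w1 * j < w2 * i)%N by nia.
  by rewrite /= ?andbF ?andbT ?addr0 ?add0r.
- rewrite ?andbF ?andbT ?addr0 ?add0r; congr ((_ : bool)%:R).
  rewrite /=; case: (posnP (i + j)) => [/eqP|p].
    by rewrite addn_eq0 => /andP[/eqP-> /eqP->]; rewrite !muln0.
  have ip : (0 < i)%N by case: i zu p => [|i] // /esym/eqP; rewrite muln0 muln_eq0; lia.
  apply/andP; split.
    rewrite -(ltn_pmul2l u1p) [(u1 * (v1 * j))%N]mulnCA -zu.
    by move: vu; rewrite -(ltn_pmul2r ip); lia.
  rewrite -(ltn_pmul2l u1p) [(u1 * (w1 * j))%N]mulnCA -zu.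
  by move: uw; rewrite -(ltn_pmul2r ip); lia.
Qed.

Lemma det_trans (v1 v2 u1 u2 w1 w2 : nat) :
  (v2 * u1 < v1 * u2)%N -> (u2 * w1 < u1 * w2)%N -> (v2 * w1 < v1 * w2)%N.
Proof.
move=> vu uw; have u1p : (0 < u1)%N by case: u1 uw vu => //; lia.
have v1p : (0 < v1)%N by case: v1 vu.
rewrite -(ltn_pmul2l u1p) (@leq_ltn_trans (v1 * (u2 * w1))) //.
  by rewrite !mulnA leq_mul2r [(u1 * v2)%N]mulnC ltnW // orbT.
by rewrite [(u1 * _)%N]mulnCA ltn_pmul2l.
Qed.

(** The decomposition of the cone multiplied by (1 - V)(1 - U)(1 - W): every series has become a
    polynomial and can be evaluated without convergence. *)
Lemma pgram_poly_split (v1 v2 u1 u2 w1 w2 : nat) : coprime u1 u2 ->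
  (v2 * u1 < v1 * u2)%N -> (u2 * w1 < u1 * w2)%N ->
  (1 - dmonom _ w1 w2) * pgram_poly v1 v2 u1 u2
  + (1 - dmonom _ v1 v2) * ((1 - dmonom _ w1 w2) * dmonom _ u1 u2)
  + (1 - dmonom _ v1 v2) * pgram_poly u1 u2 w1 w2
  = (1 - dmonom _ u1 u2) * pgram_poly v1 v2 w1 w2.
Proof.
move=> cu vu uw.
rewrite -!cone_seriesM //; last exact: det_trans vu uw.
rewrite (cone_series_split vu uw) -[X in _ + _ * (_ * X) + _](ray_seriesM cu).
ring.
Qed.

End ConeSeries.

(** * Evaluation of the cleared relation in an arbitrary commutative ring *)

Section BoxEvaluation.
Variables (M : comPzRingType) (A B : M).
Local Notation K := (fps (fps int)).

Lemma sum_ord_shift (V : nmodType) (h : nat -> V) (m n v : nat) :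
  (forall i, (m <= i)%N -> h i = 0) -> (v + m <= n)%N ->
  \sum_(i < n) (if (v <= i)%N then h (i - v)%N else 0) = \sum_(i < m) h i.
Proof.
move=> h0 vmn.
rewrite -(big_mkord xpredT h).
rewrite -(big_mkord xpredT (fun i => if (v <= i)%N then h (i - v)%N else 0)).
have vn : (v <= n)%N by lia.
rewrite (big_cat_nat (leq0n v) vn) //= big_nat_cond big1 ?add0r; last first.
  by move=> i /andP[/andP[_ iv] _]; rewrite leqNgt iv.
rewrite -{1}[v]add0n big_addn.
have mnv : (m <= n - v)%N by lia.
rewrite (big_cat_nat (leq0n m) mnv) //= [X in _ + X]big_nat_cond [X in _ + X]big1 ?addr0.
  by apply: eq_bigr => i _; rewrite leq_addl addnK.
by move=> i /andP[/andP[mi _] _]; rewrite leq_addl addnK h0.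
Qed.

Lemma sum_ord_trunc (V : nmodType) (h : nat -> V) (m n : nat) :
  (forall i, (m <= i)%N -> h i = 0) -> (m <= n)%N ->
  \sum_(i < n) h i = \sum_(i < m) h i.
Proof.
move=> h0 mn; rewrite -(@sum_ord_shift _ h m n 0) //.
by apply: eq_bigr => i _; rewrite subn0.
Qed.

(* Power series over int are evaluated at [A], [B] on a finite box, which loses
   nothing on polynomials: {poly int} has no evaluation morphism to [M], since [M]
   may be the zero ring. *)
Definition box_eval (n : nat) (f : K) : M :=
  \sum_(i < n) \sum_(j < n) (A ^+ i * B ^+ j) *~ dcoef f i j.

Definition box_bounded (n : nat) (f : K) :=
  forall i j, (n <= i)%N || (n <= j)%N -> dcoef f i j = 0.

Lemma box_evalD n f g : box_eval n (f + g) = box_eval n f + box_eval n g.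
Proof.
rewrite -big_split; apply: eq_bigr => i _; rewrite -big_split.
by apply: eq_bigr => j _; rewrite dcoefD mulrzDr.
Qed.

Lemma box_evalB n f g : box_eval n (f - g) = box_eval n f - box_eval n g.
Proof.
rewrite -sumrB; apply: eq_bigr => i _; rewrite -sumrB.
by apply: eq_bigr => j _; rewrite dcoefB mulrzBr.
Qed.

(** Truncation to a box is not multiplicative; the margin between m and n leaves room for the shift
    by (k, l), so that no term is lost. *)
Lemma box_eval_dmonomM (m n k l : nat) f :
  box_bounded m f -> (k + m <= n)%N -> (l + m <= n)%N ->
  box_eval n (dmonom _ k l * f) = A ^+ k * B ^+ l * box_eval m f.
Proof.
move=> fm kn ln.
rewrite /box_eval big_distrr /=.
pose h i := A ^+ k * B ^+ l * \sum_(j < m) (A ^+ i * B ^+ j) *~ dcoef f i j.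
rewrite -(@sum_ord_shift _ h m n k) //; last first.
  by move=> i mi; rewrite /h big1 ?mulr0 // => j _; rewrite fm ?mi // mulr0z.
apply: eq_bigr => i _; case: (leqP k i) => [ki|ik]; last first.
  by apply: big1 => j _; rewrite dcoef_dmonomM leqNgt ik /= mulr0z.
rewrite /h big_distrr /=.
pose h' j := A ^+ k * B ^+ l * (A ^+ (i - k) * B ^+ j *~ dcoef f (i - k) j).
rewrite -(@sum_ord_shift _ h' m n l) //; last first.
  by move=> j mj; rewrite /h' fm ?mj ?orbT // mulr0z mulr0.
apply: eq_bigr => j _; rewrite dcoef_dmonomM ki /=; case: leqP => // lj.
by rewrite /h' mulrzAr mulrACA -!exprD !subnKC.
Qed.

Lemma box_eval_widen (m n : nat) f :
  box_bounded m f -> (m <= n)%N -> box_eval n f = box_eval m f.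
Proof.
move=> fm mn; have := @box_eval_dmonomM m n 0 0 f fm mn mn.
have -> : dmonom _ 0 0 * f = f.
  by apply: dcoefP => i j; rewrite dcoef_dmonomM !subn0.
by rewrite !expr0 !mul1r.
Qed.

Lemma box_eval_1subM (m n k l : nat) f :
  box_bounded m f -> (k + m <= n)%N -> (l + m <= n)%N ->
  box_eval n ((1 - dmonom _ k l) * f) = (1 - A ^+ k * B ^+ l) * box_eval n f.
Proof.
move=> fm kn ln; rewrite mulrBl mul1r box_evalB (box_eval_dmonomM fm) //.
rewrite -(@box_eval_widen m n f fm) ?mulrBl ?mul1r //; lia.
Qed.

Lemma box_bounded_1subM (m n k l : nat) f :
  box_bounded m f -> (k + m <= n)%N -> (l + m <= n)%N ->
  box_bounded n ((1 - dmonom _ k l) * f).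
Proof.
move=> fm kn ln i j nij; rewrite mulrBl mul1r dcoefB dcoef_dmonomM.
by rewrite fm; last lia; case: ifP => // kl; rewrite fm ?subrr //; lia.
Qed.

Lemma box_bounded_pgram (n v1 v2 w1 w2 : nat) : (v2 * w1 < v1 * w2)%N ->
  (v1 + w1 < n)%N -> (v2 + w2 < n)%N -> box_bounded n (pgram_poly v1 v2 w1 w2).
Proof.
move=> d0 n1 n2 i j nij; rewrite /dcoef /=; case: (boolP (in_pgram _ _ _ _ _ _)) => // /(in_pgram_bound d0).
lia.
Qed.

Lemma box_eval_pgram (n v1 v2 w1 w2 : nat) : (v2 * w1 < v1 * w2)%N ->
  (v1 + w1 < n)%N -> (v2 + w2 < n)%N ->
  box_eval n (pgram_poly v1 v2 w1 w2) = pgram_sum A B v1 v2 w1 w2.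
Proof.
move=> d0 n1 n2.
pose h (i : nat) : M := \sum_(j < n) (A ^+ i * B ^+ j) *~ dcoef (pgram_poly v1 v2 w1 w2) i j.
transitivity (\sum_(i < n) h i); first by [].
rewrite (@sum_ord_trunc _ h (v1 + w1).+1) //; last first.
  move=> i vi; rewrite /h big1 // => j _; rewrite /dcoef /=.
  by case: (boolP (in_pgram _ _ _ _ _ _)) => [/(in_pgram_bound d0)[]|]; first lia.
apply: eq_bigr => i _; rewrite /h.
pose h' (j : nat) : M := (A ^+ i * B ^+ j) *~ dcoef (pgram_poly v1 v2 w1 w2) i j.
transitivity (\sum_(j < n) h' j); first by [].
rewrite (@sum_ord_trunc _ h' (v2 + w2).+1) //; last first.
  move=> j vj; rewrite /h' /dcoef /=.
  by case: (boolP (in_pgram _ _ _ _ _ _)) => [/(in_pgram_bound d0)[]|]; first lia.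
rewrite [RHS]big_mkcond; apply: eq_bigr => j _; rewrite /h' /dcoef /=.
by case: in_pgram; rewrite ?mulr0z ?mulr1z.
Qed.

(* The cone spanned by v and w is the disjoint union of the cone spanned by v
   and u, the ray of u, and the cone spanned by u and w. *)
Lemma pgram_sum_split (v1 v2 u1 u2 w1 w2 : nat) : coprime u1 u2 ->
  (v2 * u1 < v1 * u2)%N -> (u2 * w1 < u1 * w2)%N ->
  let V := A ^+ v1 * B ^+ v2 in
  let U := A ^+ u1 * B ^+ u2 in
  let W := A ^+ w1 * B ^+ w2 in
  (1 - W) * pgram_sum A B v1 v2 u1 u2 + (1 - V) * (1 - W) * U
  + (1 - V) * pgram_sum A B u1 u2 w1 w2 = (1 - U) * pgram_sum A B v1 v2 w1 w2.
Proof.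
move=> cu vu uw V U W; have vw := det_trans vu uw.
(* All the polynomials fit into a box of side m. Each factor 1 - monomial widens the box by at most
   m, and no product has more than two of them: hence 3m. *)
set m := (v1 + v2 + u1 + u2 + w1 + w2).+1; set n := (m + m + m)%N.
have := congr1 (box_eval n) (pgram_poly_split cu vu uw).
have b1 : box_bounded m 1.
  move=> i j ij; rewrite /dcoef /=; case: eqP => /= [j0|]; last by rewrite if_same.
  by case: eqP => // i0; move: ij; rewrite i0 j0 /m; lia.
have bvu : box_bounded m (pgram_poly v1 v2 u1 u2).
  by apply: box_bounded_pgram => //; rewrite /m; lia.
have buw : box_bounded m (pgram_poly u1 u2 w1 w2).
  by apply: box_bounded_pgram => //; rewrite /m; lia.
have bvw : box_bounded m (pgram_poly v1 v2 w1 w2).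
  by apply: box_bounded_pgram => //; rewrite /m; lia.
have eU : box_eval n (dmonom _ u1 u2) = U.
  rewrite -[dmonom _ _ _]mulr1 (box_eval_dmonomM b1); try by rewrite /n /m; lia.
  rewrite (@box_eval_widen 1) //; last first.
    move=> i j ij; rewrite /dcoef /=; case: eqP => /= [j0|]; last by rewrite if_same.
    by case: eqP => // i0; move: ij; rewrite i0 j0.
  by rewrite /box_eval !big_ord1 /dcoef /= !mulr1.
have bu : box_bounded m (dmonom _ u1 u2).
  move=> i j ij; rewrite dcoef_dmonom; case: eqP => //= ei; case: eqP => //= ej.
  by move: ij; rewrite ei ej /m; lia.
have bwu : box_bounded (m + m) ((1 - dmonom _ w1 w2) * dmonom _ u1 u2).
  by apply: (box_bounded_1subM bu); rewrite /m; lia.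
rewrite !box_evalD (box_eval_1subM bvu) ?(box_eval_1subM buw) ?(box_eval_1subM bvw)
  ?(box_eval_1subM bwu) ?(box_eval_1subM bu) ?eU ?box_eval_pgram //; try by rewrite /n /m; lia.
by rewrite mulrA.
Qed.

End BoxEvaluation.

Lemma in_pgram_swap v1 v2 w1 w2 i j :
  in_pgram v1 v2 w1 w2 i j = in_pgram w2 w1 v2 v1 j i.
Proof.
rewrite /in_pgram /in_cone ![(w1 * v2)%N]mulnC ![(w2 * v1)%N]mulnC.
by rewrite [X in X && _ = _]andbC [X in _ && X = _]andbC.
Qed.

(** Reflection in the diagonal reverses the orientation, so v and w trade places as well. This makes
    the shear available on the y-axis. *)
Lemma pgram_sum_swap (M : comPzRingType) (A B : M) v1 v2 w1 w2 :
  pgram_sum A B v1 v2 w1 w2 = pgram_sum B A w2 w1 v2 v1.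
Proof.
rewrite /pgram_sum (eq_bigr _ (fun _ _ => big_mkcond _ _)) exchange_big /=.
rewrite [(v2 + w2)%N]addnC [(v1 + w1)%N]addnC.
apply: eq_bigr => j _; rewrite [RHS]big_mkcond; apply: eq_bigr => i _.
by rewrite in_pgram_swap mulrC.
Qed.

(** The unimodular map (i, j) -> (i, q i + j) sends (1, 0) to (1, q) and (p2, q2) to (p2, q p2 +
    q2), and (A B^q)^i B^j is the monomial of the image of (i, j). *)
Lemma pgram_sum_shear (M : comPzRingType) (A B : M) q p2 q2 : (0 < q2)%N ->
  pgram_sum (A * B ^+ q) B 1 0 p2 q2 = pgram_sum A B 1 q p2 (q * p2 + q2).
Proof.
move=> q20; apply: eq_bigr => i _; rewrite [LHS]big_mkcond [RHS]big_mkcond /=.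
pose h j := if in_pgram 1 0 p2 q2 i j then (A * B ^+ q) ^+ i * B ^+ j else 0.
have d0 : (0 * p2 < 1 * q2)%N by rewrite mul1n.
have E i' j : in_pgram 1 q p2 (q * p2 + q2) i' (q * i' + j) = in_pgram 1 0 p2 q2 i' j.
  rewrite /in_pgram /in_cone !mul1n !mul0n.
  have -> : (q * i' < q * i' + j)%N = (0 < j)%N by lia.
  have -> : (p2 * (q * i' + j) < (q * p2 + q2) * i')%N = (p2 * j < q2 * i')%N by lia.
  have -> : (q * i' + j + q * p2 <= q * i' + (q * p2 + q2))%N = (j <= q2)%N by lia.
  have -> : ((q * p2 + q2) * i' + q * p2 <= p2 * (q * i' + j) + (q * p2 + q2))%N
            = (q2 * i' <= p2 * j + q2)%N by lia.
  by rewrite !addn0 add0n.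
(* Inside column i the shear is a shift by q * i; the longer range suffices because i <= 1 + p2. *)
rewrite -(@sum_ord_shift _ h (0 + q2).+1 (q + (q * p2 + q2)).+1 (q * i)).
- apply: eq_bigr => j _; case: leqP => [ij|ji]; last first.
    by rewrite /in_pgram /in_cone mul1n ltnNge (ltnW ji).
  rewrite /h -{3}(subnKC ij) E; case: ifP => // _.
  by rewrite exprMn -exprM -mulrA -exprD subnKC.
- by move=> j jq; rewrite /h; case: ifP => // /(in_pgram_bound d0)[]; lia.
- have ip : (i <= 1 + p2)%N by rewrite -ltnS.
  have : (q * i <= q * (1 + p2))%N by rewrite leq_mul2l ip orbT.
  lia.
Qed.

(** * Values and denominators of the terms *)

Section ConstantSeries.
Variable K : comPzRingType.
Implicit Types a b : K.

Lemma fps_constM a b : fps_const (a * b) = fps_const a * fps_const b.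
Proof.
by apply: fpsP => n; rewrite coefs_constM; case: n => [|n] //=; rewrite mulr0.
Qed.

Lemma fps_constB a b : fps_const (a - b) = fps_const a - fps_const b.
Proof. by apply: fpsP => -[|n] //=; rewrite subr0. Qed.

Lemma fps_const1 : fps_const 1 = 1 :> fps K.
Proof. by []. Qed.

Lemma fps_constX a n : fps_const (a ^+ n) = fps_const a ^+ n.
Proof. by elim: n => // n IH; rewrite !exprS fps_constM IH. Qed.

End ConstantSeries.

Section Terms.
Variable R : realType.
Local Notation C := R[i].
Local Notation Lc c := (fps_const (c : motivic C)).
Local Notation LL := (Lef C).
Local Notation LV := (Linv C).
Local Notation T := (fps_var (motivic C)).

Definition weight_monom (k a : nat) : fps (motivic C) := Lc (LV ^+ k) * T ^+ a.

Lemma weight_monomM k a l b :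
  weight_monom k a * weight_monom l b = weight_monom (k + l) (a + b).
Proof. by rewrite /weight_monom mulrACA -fps_constM -!exprD. Qed.

Lemma weight_monomX k a n : weight_monom k a ^+ n = weight_monom (k * n) (a * n).
Proof. by rewrite /weight_monom exprMn -fps_constX -!exprM. Qed.

(** If (a, b) lies on the face p alpha + q beta = N, the right side is L^-(p nu + q) T^N, the
    monomial in the factor of that face. *)
Lemma weight_monomE nu a b p q :
  weight_monom nu a ^+ p * weight_monom 1 b ^+ q =
  weight_monom (p * nu + q) (p * a + q * b).
Proof.
by rewrite !weight_monomX weight_monomM mul1n ![(p * _)%N]mulnC [(q * _)%N]mulnC.
Qed.

Lemma factorE k N : factor C k N = 1 - weight_monom k N.
Proof. by []. Qed.

Lemma in_parallelogramE (S1 S2 : face) (i j : nat) :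
  (fp S2 * fq S1 < fp S1 * fq S2)%N ->
  `[< in_parallelogram S1 S2 i j >] =
  in_pgram (fp S1) (fq S1) (fp S2) (fq S2) i j.
Proof.
case: S1 S2 => [v1 v2 N1] [w1 w2 N2] /= d0.
set d : rat := v1%:R * w2%:R - v2%:R * w1%:R.
have dp : 0 < d.
  by rewrite subr_gt0 -!natrM ltr_nat mulnC.
apply/asboolP/idP => [[m1 [m2 /= [/andP[m10 m11] /andP[m20 m21] ei ej]]]|].
  have eb : v1%:R * j%:R - v2%:R * i%:R = m2 * d by rewrite ei ej /d; ring.
  have ea : w2%:R * i%:R - w1%:R * j%:R = m1 * d by rewrite ei ej /d; ring.
  rewrite /in_pgram /in_cone -!(ltr_nat rat) -!(ler_nat rat) !natrD !natrM.
  have : 0 < m1 * d by rewrite mulr_gt0.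
  have : 0 < m2 * d by rewrite mulr_gt0.
  have : m1 * d <= d by rewrite ger_pMl.
  have : m2 * d <= d by rewrite ger_pMl.
  rewrite -ea -eb /d => ? ? ? ?.
  by apply/and3P; split; [apply/andP; split|..]; lra.
move=> /and3P[/andP[]]; rewrite -!(ltr_nat rat) -!(ler_nat rat) !natrD !natrM.
move=> b0 a0 bd ad.
exists ((w2%:R * i%:R - w1%:R * j%:R) / d), ((v1%:R * j%:R - v2%:R * i%:R) / d).
split.
- apply/andP; split; first by apply: divr_gt0; rewrite // subr_gt0.
  by rewrite ler_pdivrMr // mul1r /d; lra.
- apply/andP; split; first by apply: divr_gt0; rewrite // subr_gt0.
  by rewrite ler_pdivrMr // mul1r /d; lra.
- by rewrite /d /=; field; apply: lt0r_neq0.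
- by rewrite /d /=; field; apply: lt0r_neq0.
Qed.

Lemma vertex_sumE nu (S1 S2 : face) a b :
  (fp S2 * fq S1 < fp S1 * fq S2)%N ->
  vertex_sum R nu S1 S2 a b =
  pgram_sum (weight_monom nu a) (weight_monom 1 b) (fp S1) (fq S1) (fp S2) (fq S2).
Proof.
move=> d0; apply: eq_bigr => i _; apply: eq_big => [j|j _].
  exact: in_parallelogramE.
by rewrite weight_monomE [(nu * i)%N]mulnC.
Qed.

Lemma pgram_sum_axes (M : comPzRingType) (A B : M) : pgram_sum A B 1 0 0 1 = A * B.
Proof.
rewrite /pgram_sum !big_ord_recl !big_ord0 /= !(big_mkcond (fun j => in_pgram _ _ _ _ _ _)).
by rewrite !big_ord_recl !big_ord0 /= !add0r !addr0 /bump /= !expr1.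
Qed.

Definition cone_value nu a b v1 v2 w1 w2 : fps (motivic C) :=
  Lc ((LL - 1) ^+ 2) * pgram_sum (weight_monom nu a) (weight_monom 1 b) v1 v2 w1 w2.

Lemma value_vertex (pi : stage_path R) nu S1 S2 a b : (fp S2 * fq S1 < fp S1 * fq S2)%N ->
  value (VertexTerm pi nu S1 S2 a b) =
  cone_value nu a b (fp S1) (fq S1) (fp S2) (fq S2) *
  (factor_inv C (fp S1 * nu + fq S1) (fN S1) *
   factor_inv C (fp S2 * nu + fq S2) (fN S2)).
Proof.
by move=> d0; rewrite /value /= !big_cons big_nil mulr1 vertex_sumE.
Qed.

(** The closed formula for x^M1 (y + h)^M2 is the vertex term of a diagram with the single vertex
    (M1, M2). Base ideals thus need no separate computation later. *)
Lemma value_base (pi : stage_path R) nu M1 M2 :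
  value (BaseTerm pi nu M1 M2) =
  value (VertexTerm pi nu (Face 1 0 M1) (Face 0 1 M2) M1 M2).
Proof.
rewrite value_vertex // /cone_value pgram_sum_axes /value /= !big_cons big_nil.
by rewrite mulr1 -[X in _ * X * _ = _]mul1r !mulrA mulr1 [Linv C ^+ 1]expr1.
Qed.

(* (L - 1) L^-1 = 1 - L^-1, so that the factor 1 - L^-1 attached to the coordinate
   axis cancels, and what remains is the contribution of the ray of S. *)
Lemma value_axis_face (P U iU : fps (motivic C)) :
  P = U * weight_monom 1 0 ->
  Lc ((LL - 1) ^+ 2) * P * (iU * factor_inv C 1 0) +
  Lc ((LL - 1) * (LL - 1%:R - 1)) * U * iU =
  Lc ((LL - 1) ^+ 2) * (U * iU).
Proof.
move=> ->; have := @factorK C 1 0 isT.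
rewrite /factor /weight_monom !expr0 !expr1 !mulr1.
have : Lc LL * Lc LV = 1 by rewrite -fps_constM Lef_inv.
rewrite fps_constX !(fps_constM, fps_constB) !fps_const1.
move: (Lc LL) (Lc LV) (factor_inv C 1 0) => l v i1 lv vi.
have e : (l - 1) * v * i1 = 1 by rewrite mulrBl lv mul1r.
transitivity ((l - 1) * U * iU * ((l - 1) * v * i1 + (l - 1 - 1))); first by ring.
by rewrite e; ring.
Qed.

(** Here the factor of the face disappears: over the outer denominators the three contributions add
    up to (1 - U) P times [iU], and (1 - U) [iU] = 1. *)
Lemma cone_sum (l V U W iV iU iW P1 P2 P : fps (motivic C)) :
  (1 - V) * iV = 1 -> (1 - U) * iU = 1 -> (1 - W) * iW = 1 ->
  (1 - W) * P1 + (1 - V) * (1 - W) * U + (1 - V) * P2 = (1 - U) * P ->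
  (l * P1 * (iV * iU) + l * (U * iU) + l * P2 * (iU * iW)) * ((1 - V) * (1 - W))
  = l * P.
Proof.
move=> eV eU eW eP.
transitivity (l * iU * ((1 - W) * P1 * ((1 - V) * iV) + (1 - V) * (1 - W) * U
                        + (1 - V) * P2 * ((1 - W) * iW))); first by ring.
rewrite eV eW !mulr1 eP.
transitivity (l * P * ((1 - U) * iU)); first by ring.
by rewrite eU mulr1.
Qed.

End Terms.

(** * The sum of the terms containing the factor, for each axis *)

Section Totals.
Variable R : realType.
Local Notation C := R[i].

Lemma weight_factorK k N : (0 < k)%N ->
  (1 - weight_monom R k N) * factor_inv C k N = 1.
Proof. exact: factorK. Qed.

Lemma value_face (pi : stage_path R) nu S r :
  value (FaceTerm pi nu S r) =
  fps_const ((Lef C - 1) * (Lef C - r%:R - 1)) *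
  weight_monom R (fp S * nu + fq S) (fN S) * factor_inv C (fp S * nu + fq S) (fN S).
Proof. by rewrite /value /= big_cons big_nil mulr1. Qed.

(** Everything is expressed by the monomials A = L^-nu T^a and B = L^-1 T^e of the upper vertex (a,
    e). At the corner (N, e) of the second diagram A is replaced by L^-(nu + q) T^N = A B^q, so the
    shear places its cone between (1, q) and (w1, q w1 + w2). *)
Lemma x_axis_total (pi pi' : stage_path R) nu q a e N v1 v2 Nv w1 w2 Nw :
  (0 < nu)%N -> N = (a + q * e)%N -> (v2 < v1 * q)%N -> (0 < w2)%N ->
  Nv = (v1 * a + v2 * e)%N -> Nw = (w1 * N + w2 * e)%N ->
  let S := Face 1 q N in
  (value (VertexTerm pi nu (Face v1 v2 Nv) S a e) +
   (value (VertexTerm pi nu S (Face 0 1 0) N 0) + value (FaceTerm pi nu S 1)) +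
   value (VertexTerm pi' (nu + q) (Face 1 0 N) (Face w1 w2 Nw) N e)) *
  (factor C (v1 * nu + v2) Nv * factor C (w1 * (nu + q) + w2) Nw) =
  cone_value R nu a e v1 v2 w1 (q * w1 + w2).
Proof.
move=> nu0 eN vu w20 eNv eNw S.
have v10 : (0 < v1)%N by move: vu; case: (v1).
rewrite !value_vertex /= ?value_face /=; try lia.
set U := weight_monom R (nu + q) N.
have eU : weight_monom R nu a ^+ 1 * weight_monom R 1 e ^+ q = U.
  by rewrite /U weight_monomE !mul1n eN.
have UE : U = U by []; rewrite {1}/U in UE; clearbody U.
(* The cone at (N, 0) is the sheared quadrant: its parallelogram contains the single lattice point
   (1, q + 1). *)
have axis : pgram_sum (weight_monom R nu N) (weight_monom R 1 0) 1 q 0 1 =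
            U * weight_monom R 1 0.
  have := @pgram_sum_shear _ (weight_monom R nu N) (weight_monom R 1 0) q 0 1 isT.
  rewrite muln0 add0n => <-; rewrite pgram_sum_axes weight_monomX weight_monomM.
  by rewrite mul1n mul0n addn0 UE.
have new : pgram_sum (weight_monom R (nu + q) N) (weight_monom R 1 e) 1 0 w1 w2 =
           pgram_sum (weight_monom R nu a) (weight_monom R 1 e) 1 q w1 (q * w1 + w2).
  by rewrite -(pgram_sum_shear _ _ q w1 w20) UE -eU expr1.
rewrite !mul1n !mul0n !add0n !addn0 [cone_value _ _ N 0 _ _ _ _]/cone_value UE (value_axis_face _ axis).
rewrite /cone_value new !factorE.
apply: cone_sum.
- by apply: weight_factorK; rewrite addn_gt0 muln_gt0 v10 nu0.
- by rewrite -UE; apply: weight_factorK; rewrite addn_gt0 nu0.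
- by apply: weight_factorK; rewrite addn_gt0 w20 orbT.
have -> : weight_monom R (v1 * nu + v2) Nv =
          weight_monom R nu a ^+ v1 * weight_monom R 1 e ^+ v2.
  by rewrite weight_monomE eNv.
(* The sheared vector keeps its weight, w1 (nu + q) + w2 = w1 nu + (q w1 + w2), and by N = a + q e
   also its power of T. *)
have -> : weight_monom R (w1 * (nu + q) + w2) Nw =
          weight_monom R nu a ^+ w1 * weight_monom R 1 e ^+ (q * w1 + w2).
  by rewrite weight_monomE eNw eN; congr weight_monom; lia.
rewrite -eU; apply: pgram_sum_split; first exact: coprime1n.
- by rewrite muln1.
- by rewrite mul1n; lia.
Qed.

(** The mirror image, at the lower vertex (e, b): the transformed cone now lies to the left of (p,
    1), between (p w1 + w2, w1) and (p, 1). Its weight w1 (p + 1) + w2 agrees with that of the image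
    vector since x and y both have weight 1. *)
Lemma y_axis_total (pi pi' : stage_path R) p b e N v1 v2 Nv w1 w2 Nw :
  N = (p * e + b)%N -> (v1 < p * v2)%N -> (0 < w2)%N ->
  Nv = (v1 * e + v2 * b)%N -> Nw = (w1 * N + w2 * e)%N ->
  let S := Face p 1 N in
  (value (VertexTerm pi 1 S (Face v1 v2 Nv) e b) +
   (value (VertexTerm pi 1 (Face 1 0 0) S 0 N) + value (FaceTerm pi 1 S 1)) +
   value (VertexTerm pi' (p + 1) (Face 1 0 N) (Face w1 w2 Nw) N e)) *
  (factor C (w1 * (p + 1) + w2) Nw * factor C (v1 + v2) Nv) =
  cone_value R 1 e b (p * w1 + w2) w1 v1 v2.
Proof.
move=> eN uv w20 eNv eNw S.
have v20 : (0 < v2)%N by move: uv; case: (v2) => //; rewrite muln0.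
have p0 : (0 < p)%N by move: uv; case: (p).
rewrite !value_vertex /= ?value_face /=; try lia.
set U := weight_monom R (p + 1) N.
have eU : weight_monom R 1 e ^+ p * weight_monom R 1 b ^+ 1 = U.
  by rewrite /U weight_monomE muln1 mul1n eN.
have UE : U = U by []; rewrite {1}/U in UE; clearbody U.
have axis : pgram_sum (weight_monom R 1 0) (weight_monom R 1 N) 1 0 p 1 =
            U * weight_monom R 1 0.
  have := @pgram_sum_shear _ (weight_monom R 1 N) (weight_monom R 1 0) p 0 1 isT.
  rewrite muln0 add0n => H; rewrite pgram_sum_swap -H pgram_sum_axes weight_monomX weight_monomM.
  by rewrite mul1n mul0n addn0 addnC UE.
have new : pgram_sum (weight_monom R (p + 1) N) (weight_monom R 1 e) 1 0 w1 w2 =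
           pgram_sum (weight_monom R 1 e) (weight_monom R 1 b) (p * w1 + w2) w1 p 1.
  rewrite [RHS]pgram_sum_swap -(pgram_sum_shear _ _ p w1 w20) UE -eU expr1.
  by rewrite [_ ^+ p * _]mulrC.
rewrite !muln1 !mul1n !addn0 [cone_value _ _ 0 _ _ _ _ _]/cone_value.
rewrite UE [factor_inv C 1 0 * _]mulrC (value_axis_face _ axis) /cone_value new !factorE.
set L := fps_const _; set iU := factor_inv C (p + 1) N.
set iV := factor_inv _ _ Nv; set iW := factor_inv _ _ Nw.
set V := weight_monom R (v1 + v2) Nv; set W := weight_monom R _ Nw.
rewrite [X in X * _](_ : _ = L * pgram_sum (weight_monom R 1 e) (weight_monom R 1 b)
  (p * w1 + w2) w1 p 1 * (iW * iU) + L * (U * iU) +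
  L * pgram_sum (weight_monom R 1 e) (weight_monom R 1 b) p 1 v1 v2 * (iU * iV));
  last by ring.
apply: cone_sum.
- by apply: weight_factorK; rewrite addn_gt0 w20 orbT.
- by rewrite -UE; apply: weight_factorK; rewrite addn1.
- by apply: weight_factorK; rewrite addn_gt0 v20 orbT.
have -> : V = weight_monom R 1 e ^+ v1 * weight_monom R 1 b ^+ v2.
  by rewrite /V weight_monomE eNv muln1.
have -> : W = weight_monom R 1 e ^+ (p * w1 + w2) * weight_monom R 1 b ^+ w1.
  by rewrite /W weight_monomE eNw eN; congr weight_monom; lia.
rewrite -eU; apply: pgram_sum_split; first exact: coprimen1.
- by rewrite muln1; lia.
- by rewrite mul1n.
Qed.

End Totals.

(** * Polynomials in T and denominators of sums of terms *)

Section Polynomials.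
Variable K : comPzRingType.
Implicit Types f g : fps K.

Lemma is_polynomialD f g :
  is_polynomial f -> is_polynomial g -> is_polynomial (f + g).
Proof.
move=> [m fm] [n gn]; exists (m + n)%N => i mni.
have -> : coefs (f + g) i = coefs f i + coefs g i by [].
by rewrite fm ?gn ?addr0 //; lia.
Qed.

Lemma is_polynomialM f g :
  is_polynomial f -> is_polynomial g -> is_polynomial (f * g).
Proof.
move=> [m fm] [n gn]; exists (m + n)%N => k mnk; rewrite coefsM big1 // => i _.
have [mi|im] := leqP m i; first by rewrite fm // mul0r.
by rewrite gn ?mulr0 //; lia.
Qed.

Lemma is_polynomial_const (c : K) : is_polynomial (fps_const c).
Proof. by exists 1%N => -[]. Qed.

Lemma is_polynomialN f : is_polynomial f -> is_polynomial (- f).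
Proof.
by move=> [m fm]; exists m => n /fm e; rewrite -[LHS]/(- coefs f n) e oppr0.
Qed.

Lemma is_polynomial_prod (T : Type) (r : seq T) (P : pred T) (F : T -> fps K) :
  (forall i, is_polynomial (F i)) -> is_polynomial (\prod_(i <- r | P i) F i).
Proof.
move=> Fp; apply: big_ind => [||i _] //; first exact: is_polynomial_const.
exact: is_polynomialM.
Qed.

Lemma is_polynomial_sum (T : Type) (r : seq T) (P : pred T) (F : T -> fps K) :
  (forall i, is_polynomial (F i)) -> is_polynomial (\sum_(i <- r | P i) F i).
Proof.
move=> Fp; apply: big_ind => [||i _] //; first exact: is_polynomial_const.
exact: is_polynomialD.
Qed.

Lemma is_polynomial_varX n : is_polynomial (fps_var K ^+ n).
Proof.
exists n.+1 => k nk; rewrite -[fps_var K ^+ n]mulr1 coefs_varXM coefs1.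
by rewrite (ltnW nk) subn_eq0 leqNgt nk.
Qed.

Lemma is_polynomialX f n : is_polynomial f -> is_polynomial (f ^+ n).
Proof.
move=> fp; elim: n => [|n IH]; first exact: is_polynomial_const.
by rewrite exprS; apply: is_polynomialM.
Qed.

End Polynomials.

Section Denominators.
Variable R : realType.
Local Notation C := R[i].

Lemma is_polynomial_weight_monom k a : is_polynomial (weight_monom R k a).
Proof.
by apply: is_polynomialM; [exact: is_polynomial_const|exact: is_polynomial_varX].
Qed.

Lemma is_polynomial_factor k N : is_polynomial (factor C k N).
Proof.
rewrite factorE; apply: is_polynomialD; first exact: is_polynomial_const.
exact/is_polynomialN/is_polynomial_weight_monom.
Qed.

Lemma is_polynomial_numerator (t : zeta_term R) : is_polynomial (numerator t).
Proof.
case: t => [pi nu S1 S2 a b|pi nu S r|pi nu M1 M2] /=.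
- apply: is_polynomialM; first exact: is_polynomial_const.
  apply: is_polynomial_sum => i; apply: is_polynomial_sum => j.
  exact: is_polynomial_weight_monom.
- apply: is_polynomialM; first exact: is_polynomial_const.
  exact: is_polynomial_weight_monom.
- apply: is_polynomialM; last exact: (is_polynomial_weight_monom 1).
  apply: is_polynomialM; first exact: is_polynomial_const.
  exact: is_polynomial_weight_monom.
Qed.

Lemma is_polynomial_cone_value nu a b v1 v2 w1 w2 :
  is_polynomial (cone_value R nu a b v1 v2 w1 w2).
Proof.
apply: is_polynomialM; first exact: is_polynomial_const.
apply: is_polynomial_sum => i; apply: is_polynomial_sum => j.
by apply: is_polynomialM; apply: is_polynomialX; exact: is_polynomial_weight_monom.
Qed.

Variables (I0 : seq (series2 R)) (nu0 : nat).
Hypothesis nu0_gt0 : (0 < nu0)%N.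
Local Notation occurs := (occurs I0 nu0).
Local Notation stage := (stage I0 nu0).

Lemma face_weight_gt0 (I : seq (series2 R)) S nu :
  is_face I S -> (0 < nu)%N -> (0 < fp S * nu + fq S)%N.
Proof.
move=> [cS _ _] nu_gt0; case: S cS => [p q N] /= cpq.
by rewrite addn_gt0 muln_gt0 nu_gt0 andbT; case: p q cpq => [|p] [|q].
Qed.

Lemma stage_form_gt0 pi I nu : stage pi I nu -> (0 < nu)%N.
Proof. by elim=> // {}pi {}I {}nu S mu p' q' _ nu_gt0 _ [/face_weight_gt0->]. Qed.

(** A positive k makes 1 - L^-k T^N invertible even for N = 0, where the factor is a constant. *)
Lemma occurs_weight_gt0 t f : occurs t -> f \in denominator t -> (0 < f.2.1)%N.
Proof.
case=> [pi I nu S1 S2 a b st _ [F1 F2 _ _ _]|pi I nu S r st _ [F _ _] _|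
        pi I nu M1 M2 st _ _] /=; have nu_gt0 := stage_form_gt0 st; rewrite !inE.
- by move=> /orP[] /eqP-> /=; [exact: face_weight_gt0 F1 _|exact: face_weight_gt0 F2 _].
- by move=> /eqP-> /=; exact: face_weight_gt0 F _.
- by move=> /orP[] /eqP-> //=; rewrite mul1n addn0.
Qed.

Lemma value_denominatorM t : occurs t ->
  value t * \prod_(f <- denominator t) factor C f.2.1 f.2.2 = numerator t.
Proof.
move=> ot; rewrite /value -mulrA -big_split /= big_seq big1 ?mulr1 // => f ft.
by rewrite mulrC factorK // (occurs_weight_gt0 ot ft).
Qed.

Lemma denominator_avoidsD S Z1 Z2 :
  denominator_avoids I0 nu0 S Z1 -> denominator_avoids I0 nu0 S Z2 ->
  denominator_avoids I0 nu0 S (Z1 + Z2).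
Proof.
move=> [fs1 [P1 [fs1S P1p e1]]] [fs2 [P2 [fs2S P2p e2]]].
pose Q fs := \prod_(f <- fs : seq (den_factor R)) factor C f.2.1 f.2.2.
have Qp fs : is_polynomial (Q fs).
  by apply: is_polynomial_prod => f; exact: is_polynomial_factor.
exists (fs1 ++ fs2), (P1 * Q fs2 + P2 * Q fs1); split.
- by move=> f; rewrite mem_cat => /orP[/fs1S|/fs2S].
- by apply: is_polynomialD; apply: is_polynomialM.
- by rewrite big_cat /= -/(Q fs1) -/(Q fs2) -e1 -e2 -/(Q fs1) -/(Q fs2); ring.
Qed.

Lemma denominator_avoids_value S t : occurs t -> ~~ contains_factor_of S t ->
  denominator_avoids I0 nu0 S (value t).
Proof.
move=> ot St; exists (denominator t), (numerator t); split.
- move=> f ft; split; last by exists t.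
  by move=> fS; move/negP: St; apply; rewrite /contains_factor_of -fS map_f.
- exact: is_polynomial_numerator.
- exact: value_denominatorM.
Qed.

(** Every remaining term avoids the factor by itself, and two enumerations of the terms containing
    it are permutations of each other; the claim on the whole zeta function therefore follows from
    the claim on these terms. *)
Lemma factor_does_not_appearP S :
  (exists ts, enumerates ts (fun t => occurs t /\ contains_factor_of S t) /\
     denominator_avoids I0 nu0 S (\sum_(t <- ts) value t)) ->
  factor_does_not_appear I0 nu0 S.
Proof.
move=> [ts [[uts tsP] avoid]]; split; first by exists ts.
move=> ts' [uts' ts'P] ->; rewrite (bigID (contains_factor_of S)) /=.
apply: denominator_avoidsD.
  rewrite -big_filter (perm_big ts) //; apply: uniq_perm => //.
    exact: filter_uniq.
  move=> t; rewrite mem_filter; apply/andP/idP => [[St /ts'P ot]|/tsP[ot St]].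
    by apply/tsP.
  by split=> //; apply/ts'P.
rewrite big_seq_cond; apply: big_ind.
- exists [::], 0; split=> //; first exact: (is_polynomial_const 0).
  by rewrite mul0r.
- exact: denominator_avoidsD.
- by move=> t /andP[/ts'P ot St]; apply: denominator_avoids_value.
Qed.

End Denominators.

(** * Faces of the Newton diagram *)

Section Lattice.
Implicit Types A : nat -> nat -> Prop.

(* Among the points of A below the vertex, one of minimal slope as seen from
   the vertex; slopes are scaled by b! to become natural numbers. *)
Lemma next_face_exists A a b p1 q1 : A a b -> (0 < p1)%N ->
  (forall i j, A i j -> p1 * a + q1 * b <= p1 * i + q1 * j)%N ->
  (forall i j, A i j -> p1 * i + q1 * j = p1 * a + q1 * b -> b <= j)%N ->
  exists p q, [/\ coprime p q, (p * q1 < p1 * q)%N,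
    (forall i j, A i j -> p * a + q * b <= p * i + q * j)%N &
    exists i j k l, [/\ A k l, (k <= i)%N, (l <= j)%N, (i, j) <> (a, b) &
                        (p * i + q * j = p * a + q * b)%N]].
Proof.
move=> Aab p10 bd1 end1.
have right i j : A i j -> (j < b)%N -> (a < i)%N.
  move=> Aij jb; rewrite ltnNge; apply/negP => ia.
  have := bd1 _ _ Aij; have := end1 _ _ Aij.
  have : (p1 * i <= p1 * a)%N by rewrite leq_mul2l ia orbT.
  have : (q1 * j <= q1 * b)%N by rewrite leq_mul2l (ltnW jb) orbT.
  by lia.
have [[i0 [j0 [A0 j0b]]]|none] := pselect (exists i j, A i j /\ (j < b)%N); last first.
  (* Nothing lies below the vertex: the next face is horizontal. Its second point (a + 1, b) need
     not be in [A]; it only dominates a point of [A]. *)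
  exists 0%N, 1%N; split=> //; first by rewrite muln1.
    move=> i j Aij; rewrite !mul0n !mul1n !add0n leqNgt; apply/negP => jb.
    by apply: none; exists i, j.
  by exists a.+1, b, a, b; split=> // -[]; lia.
pose key i j := ((i - a) * (b`! %/ (b - j)))%N.
pose P n := `[< exists i j, [/\ A i j, (j < b)%N & n = key i j] >].
have exP : exists n, P n by exists (key i0 j0); apply/asboolP; exists i0, j0.
case: (ex_minnP exP) => n /asboolP[i [j [Aij jb ->]]] min {i0 j0 A0 j0b n exP}.
have ai := right _ _ Aij jb.
have keyE i' j' : (j' < b)%N -> (key i' j' * (b - j') = (i' - a) * b`!)%N.
  by move=> jb'; rewrite /key -mulnA divnK // dvdn_fact // subn_gt0 jb' leq_subr.
have slope i' j' : A i' j' -> (j' < b)%N ->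
    ((i - a) * (b - j') <= (i' - a) * (b - j))%N.
  move=> Aij' jb'; have : P (key i' j') by apply/asboolP; exists i', j'.
  move/min => kk; have f0 := fact_gt0 b.
  rewrite -(leq_pmul2r f0).
  have -> : ((i - a) * (b - j') * b`! = key i j * ((b - j) * (b - j')))%N.
    by rewrite mulnAC -(keyE i j) // mulnA.
  have -> : ((i' - a) * (b - j) * b`! = key i' j' * ((b - j) * (b - j')))%N.
    by rewrite mulnAC -(keyE i' j') // -mulnA [((b - j') * _)%N]mulnC.
  by rewrite leq_mul2r kk orbT.
have [x ex] : exists x, i = (a + x)%N by exists (i - a)%N; lia.
have [y ey] : exists y, b = (j + y)%N by exists (b - j)%N; lia.
have x0 : (0 < x)%N by lia.
have y0 : (0 < y)%N by lia.
pose g := gcdn y x; have g0 : (0 < g)%N by rewrite gcdn_gt0 y0.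
exists (y %/ g)%N, (x %/ g)%N.
have yE : (y %/ g * g = y)%N by rewrite divnK ?dvdn_gcdl.
have xE : (x %/ g * g = x)%N by rewrite divnK ?dvdn_gcdr.
(* By [end1] the lower point (i, j) is not on the line of the given face, so the inequality is
   strict. *)
have det : (y * q1 < p1 * x)%N.
  have := bd1 _ _ Aij; have := end1 _ _ Aij.
  rewrite ex ey; lia.
have scale u v u' v' : (y * u + x * v <= y * u' + x * v')%N ->
    (y %/ g * u + x %/ g * v <= y %/ g * u' + x %/ g * v')%N.
  by move=> H; rewrite -(leq_pmul2l g0) !mulnDr !mulnA ![(g * (_ %/ _))%N]mulnC yE xE.
split.
- rewrite /coprime -(eqn_pmul2r g0) -[X in _ == X]/(1 * g)%N mul1n.
  by rewrite muln_gcdl yE xE.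
- by rewrite -(ltn_pmul2r g0); lia.
- move=> i' j' Aij'; apply: scale.
  have [jb'|bj'] := ltnP j' b.
    have := slope _ _ Aij' jb'; have := right _ _ Aij' jb' => ai'.
    have [x' ->] : exists x', i' = (a + x')%N by exists (i' - a)%N; lia.
    have [y' eb] : exists y', b = (j' + y')%N by exists (b - j')%N; lia.
    have -> : (i - a = x)%N by lia.
    have -> : (b - j = y)%N by lia.
    have -> : (b - j' = y')%N by lia.
    have -> : (a + x' - a = x')%N by lia.
    by rewrite eb; lia.
  have [ai'|ia'] := leqP a i'.
    by rewrite leq_add // leq_mul2l ?ai' ?bj' orbT.
  (* To the upper left of the vertex the given face already bounds the points, and [det] compares
     the two slopes. *)
  have := bd1 _ _ Aij'.
  have [x' ->] : exists x', a = (i' + x')%N by exists (a - i')%N; lia.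
  have [y' ->] : exists y', j' = (b + y')%N by exists (j' - b)%N; lia.
  move=> H; have {}H : (p1 * x' <= q1 * y')%N by lia.
  suff : (y * x' <= x * y')%N by lia.
  rewrite -(leq_pmul2l p10).
  have : (y * (p1 * x') <= y * (q1 * y'))%N by rewrite leq_mul2l H orbT.
  have : (y' * (y * q1) <= y' * (p1 * x))%N by rewrite leq_mul2l (ltnW det) orbT.
  lia.
- exists i, j, i, j; split=> //; first by move=> [] ?; lia.
  apply/eqP; rewrite eqn_leq.
  by rewrite ex ey; apply/andP; split; apply: scale; lia.
Qed.

(** Both vertices lie on the line of (p, q). Since each candidate face is minimal at its own vertex,
    the determinants give b <= b' and b' <= b. At the common vertex, the second point of each face
    tests the other face, so the slopes agree, and coprimality gives equal vectors. The relation [D]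
    is kept abstract so that the coordinates can be exchanged. *)
Lemma next_face_unique (F : realFieldType) (D : F -> F -> Prop)
    (p q p1 q1 p2 q2 : nat) (a b a' b' : F) :
  coprime p1 q1 -> (p1 * q < p * q1)%N -> coprime p2 q2 -> (p2 * q < p * q2)%N ->
  D a b -> D a' b' -> p%:R * a + q%:R * b = p%:R * a' + q%:R * b' ->
  (forall x y, D x y -> p%:R * a + q%:R * b <= p%:R * x + q%:R * y) ->
  (forall x y, D x y -> p1%:R * a + q1%:R * b <= p1%:R * x + q1%:R * y) ->
  (forall x y, D x y -> p2%:R * a' + q2%:R * b' <= p2%:R * x + q2%:R * y) ->
  (exists x y, [/\ D x y, (x, y) <> (a, b) &
                   p1%:R * x + q1%:R * y = p1%:R * a + q1%:R * b]) ->
  (exists x y, [/\ D x y, (x, y) <> (a', b') &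
                   p2%:R * x + q2%:R * y = p2%:R * a' + q2%:R * b']) ->
  [/\ a = a', b = b', p1 = p2 & q1 = q2].
Proof.
move=> c1 d1 c2 d2 Dab Dab' eab bd bd1 bd2 [x1 [y1 [D1 n1 e1]]] [x2 [y2 [D2 n2 e2]]].
have p0 : 0 < p%:R :> F by rewrite ltr0n; case: p d1 {d2 eab bd} => //.
have q10 : 0 < q1%:R :> F by rewrite ltr0n; case: q1 d1 {c1 bd1 e1}; lia.
have q20 : 0 < q2%:R :> F by rewrite ltr0n; case: q2 d2 {c2 bd2 e2}; lia.
have D10 : 0 < p%:R * q1%:R - p1%:R * q%:R :> F by rewrite subr_gt0 -!natrM ltr_nat.
have D20 : 0 < p%:R * q2%:R - p2%:R * q%:R :> F by rewrite subr_gt0 -!natrM ltr_nat.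
have h1 : 0 <= p%:R * ((p1%:R * a' + q1%:R * b') - (p1%:R * a + q1%:R * b)).
  by rewrite mulr_ge0 ?(ltW p0) // subr_ge0 bd1.
have h2 : 0 <= p%:R * ((p2%:R * a + q2%:R * b) - (p2%:R * a' + q2%:R * b')).
  by rewrite mulr_ge0 ?(ltW p0) // subr_ge0 bd2.
have eb : b = b'.
  apply/eqP; rewrite eq_le; apply/andP; split; rewrite -subr_ge0.
    rewrite -(pmulr_rge0 _ D10); have := h1.
    have -> : p%:R * ((p1%:R * a' + q1%:R * b') - (p1%:R * a + q1%:R * b)) =
      p1%:R * ((p%:R * a' + q%:R * b') - (p%:R * a + q%:R * b)) +
      (p%:R * q1%:R - p1%:R * q%:R) * (b' - b) by ring.
    by rewrite eab subrr mulr0 add0r.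
  rewrite -(pmulr_rge0 _ D20); have := h2.
  have -> : p%:R * ((p2%:R * a + q2%:R * b) - (p2%:R * a' + q2%:R * b')) =
    p2%:R * ((p%:R * a + q%:R * b) - (p%:R * a' + q%:R * b')) +
    (p%:R * q2%:R - p2%:R * q%:R) * (b - b') by ring.
  by rewrite eab subrr mulr0 add0r.
have ea : a = a'.
  by apply: (mulfI (lt0r_neq0 p0)); move: eab; rewrite eb => /addIr.
subst a' b'.
(* The second point of the face (r, s) is strictly to the right of the vertex; minimality of (r',
   s') at the vertex then compares the slopes. *)
have half (r s r' s' : nat) x y : 0 < s%:R :> F ->
    0 < p%:R * s%:R - r%:R * q%:R :> F -> D x y -> (x, y) <> (a, b) ->
    r%:R * x + s%:R * y = r%:R * a + s%:R * b ->
    (forall x y, D x y -> r'%:R * a + s'%:R * b <= r'%:R * x + s'%:R * y) ->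
    (r * s' <= r' * s)%N.
  move=> s0 d0 Dxy nxy exy bd'.
  have dx0 : 0 <= x - a.
    rewrite -(pmulr_rge0 _ d0).
    have : 0 <= s%:R * ((p%:R * x + q%:R * y) - (p%:R * a + q%:R * b)).
      by rewrite mulr_ge0 ?(ltW s0) // subr_ge0 bd.
    have -> : s%:R * ((p%:R * x + q%:R * y) - (p%:R * a + q%:R * b)) =
      q%:R * ((r%:R * x + s%:R * y) - (r%:R * a + s%:R * b)) +
      (p%:R * s%:R - r%:R * q%:R) * (x - a) by ring.
    by rewrite exy subrr mulr0 add0r.
  have dx : 0 < x - a.
    rewrite lt_neqAle dx0 andbT eq_sym subr_eq0; apply/negP => /eqP xa.
    apply: nxy; congr pair => //; apply: (mulfI (lt0r_neq0 s0)).
    by move: exy; rewrite xa => /addrI.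
  rewrite -(ler_nat F) !natrM -subr_ge0 -(pmulr_rge0 _ dx) mulrC.
  have : 0 <= s%:R * ((r'%:R * x + s'%:R * y) - (r'%:R * a + s'%:R * b)).
    by rewrite mulr_ge0 ?(ltW s0) // subr_ge0 bd'.
  have -> : s%:R * ((r'%:R * x + s'%:R * y) - (r'%:R * a + s'%:R * b)) =
    s'%:R * ((r%:R * x + s%:R * y) - (r%:R * a + s%:R * b)) +
    (r'%:R * s%:R - r%:R * s'%:R) * (x - a) by ring.
  by rewrite exy subrr mulr0 add0r.
have e : (p1 * q2 = p2 * q1)%N.
  apply/eqP; rewrite eqn_leq (half _ _ _ _ _ _ q10 D10 D1 n1 e1 bd2).
  by rewrite (half _ _ _ _ _ _ q20 D20 D2 n2 e2 bd1).
have q12 : q1 = q2.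
  apply/eqP; rewrite eqn_dvd; apply/andP; split.
    have : (q1 %| p1 * q2)%N by rewrite e dvdn_mull.
    by rewrite Gauss_dvdr // coprime_sym.
  have : (q2 %| p2 * q1)%N by rewrite -e dvdn_mull.
  by rewrite Gauss_dvdr // coprime_sym.
split=> //; apply/eqP; rewrite -(@eqn_pmul2r q1); last by rewrite -(ltr0n F).
by rewrite -e q12.
Qed.

End Lattice.

(** * The diagram and the support of the generators *)

Section Diagram.
Variable R : realType.
Implicit Types (I : seq (series2 R)) (S : face).

Definition in_support I (al be : nat) :=
  exists2 f, f \in I & coef2 f al be != 0.

(** A half-plane is convex; with natural p and q it contains the quadrant above each of its points,
    hence the whole diagram. *)
Lemma diagram_ge I (p q N : nat) :
  (forall al be, in_support I al be -> N <= p * al + q * be)%N ->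
  forall z : plane R, newton_diagram I z -> N%:R <= p%:R * z.1 + q%:R * z.2.
Proof.
move=> H z dz.
apply: (dz [set z : plane R | N%:R <= p%:R * z.1 + q%:R * z.2]%classic).
split; last first.
  move=> w [f [al [be [fI fn0 z1 z2]]]] /=.
  apply: (@le_trans _ _ (p%:R * al%:R + q%:R * be%:R)).
    by rewrite -!natrM -natrD ler_nat; apply: H; exists f.
  by apply: lerD; apply: ler_wpM2l.
move=> x y t; rewrite !inE /= => xA yA; set s := interval_inference.Itv.r t.
rewrite [X in _ <= X](_ : _ = s * (p%:R * x.1 + q%:R * x.2) +
  (1 - s) * (p%:R * y.1 + q%:R * y.2)); last first.
  rewrite -[LHS]/(p%:R * (s * x.1 + (1 - s) * y.1) +
                  q%:R * (s * x.2 + (1 - s) * y.2)).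
  ring.
have t0 : 0 <= s by exact: interval_inference.ge0.
have t1 : 0 <= 1 - s by rewrite subr_ge0; exact: interval_inference.le1.
apply: (@le_trans _ _ (s * N%:R + (1 - s) * N%:R)).
  by rewrite -mulrDl addrC subrK mul1r.
by apply: lerD; apply: ler_wpM2l.
Qed.

Lemma diagram_support I al be (i j : nat) : in_support I al be ->
  (al <= i)%N -> (be <= j)%N -> newton_diagram I (i%:R, j%:R).
Proof.
move=> [f fI fn0] ali bej A [_]; apply.
by exists f, al, be; split=> //=; rewrite ler_nat.
Qed.

End Diagram.

Section Faces.
Variable R : realType.
Implicit Types (I : seq (series2 R)) (S : face).

Lemma natr_line (p q a b N : nat) :
  (p%:R * a%:R + q%:R * b%:R == N%:R :> R) = (p * a + q * b == N)%N.
Proof. by rewrite -!natrM -natrD eqr_nat. Qed.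

Lemma face_support_ge I S al be : is_face I S -> in_support I al be ->
  (fN S <= fp S * al + fq S * be)%N.
Proof.
move=> [_ ge _] sab; rewrite -(ler_nat R) natrD !natrM.
exact: (ge _ (diagram_support sab (leqnn _) (leqnn _))).
Qed.

Lemma lattice_face I p q N i j i' j' : coprime p q ->
  (forall al be, in_support I al be -> N <= p * al + q * be)%N ->
  newton_diagram I (i%:R, j%:R) -> (p * i + q * j = N)%N ->
  newton_diagram I (i'%:R, j'%:R) -> (p * i' + q * j' = N)%N ->
  (i, j) <> (i', j') -> is_face I (Face p q N).
Proof.
move=> cpq ge d e d' e' ne; split=> //=; first exact: diagram_ge.
exists (i%:R, j%:R), (i'%:R, j'%:R); split.
- by case=> /eqP + /eqP; rewrite !eqr_nat => /eqP ei /eqP ej; apply: ne; rewrite ei ej.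
- by split=> //=; apply/eqP; rewrite natr_line e.
- by split=> //=; apply/eqP; rewrite natr_line e'.
Qed.

Lemma consecutive_vertex I S1 S2 a b : consecutive I S1 S2 a b ->
  [/\ newton_diagram I (a%:R, b%:R), (fp S1 * a + fq S1 * b = fN S1)%N &
      (fp S2 * a + fq S2 * b = fN S2)%N].
Proof.
by move=> [_ _ _ [d /eqP +] [_ /eqP]]; rewrite !natr_line => /eqP ? /eqP.
Qed.

Lemma face_second_point I S (z : plane R) : is_face I S -> face_set I S z ->
  exists w, [/\ newton_diagram I w, w <> z &
    (fp S)%:R * w.1 + (fq S)%:R * w.2 = (fp S)%:R * z.1 + (fq S)%:R * z.2].
Proof.
move=> [_ _ [w [w' [ww' [dw ew] [dw' ew']]]]] [dz ez].
have [wz|wz] := eqVneq w z.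
  by exists w'; split=> //; [rewrite -wz => /esym|rewrite ew' ez].
by exists w; split=> //; [apply/eqP|rewrite ew ez].
Qed.

Lemma consecutive_right_unique I S S1 S2 a b a' b' :
  consecutive I S S1 a b -> consecutive I S S2 a' b' ->
  [/\ S1 = S2, a = a' & b = b'].
Proof.
move=> c1 c2; have [d1 e1 f1] := consecutive_vertex c1.
have [d2 e2 f2] := consecutive_vertex c2.
case: c1 c2 => [[cS ge _] F1 det1 _ v1] [_ F2 det2 _ v2].
have [[x1 y1] [dz1 n1 z1]] := face_second_point F1 v1.
have [[x2 y2] [dz2 n2 z2]] := face_second_point F2 v2.
case: F1 F2 => [cS1 ge1 _] [cS2 ge2 _].
suff : [/\ a%:R = a'%:R :> R, b%:R = b'%:R :> R, fp S1 = fp S2 & fq S1 = fq S2].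
  move=> [/eqP + /eqP + p12 q12]; rewrite !eqr_nat => /eqP aa /eqP bb; split=> //.
  case: S1 S2 p12 q12 f1 f2 {det1 det2 v1 v2 z1 z2 cS1 cS2 ge1 ge2} => [p q N] [p' q' N'] /=.
  by move=> <- <- <- <-; rewrite aa bb.
apply: (@next_face_unique R (fun x y => newton_diagram I (x, y))
  (fp S) (fq S) (fp S1) (fq S1) (fp S2) (fq S2) a%:R b%:R a'%:R b'%:R) => //.
- by rewrite -!natrM -!natrD e1 e2.
- by move=> x y /ge; rewrite /= -e1 natrD !natrM.
- by move=> x y /ge1; rewrite /= -f1 natrD !natrM.
- by move=> x y /ge2; rewrite /= -f2 natrD !natrM.
- by exists x1, y1; split.
- by exists x2, y2; split.
Qed.

Lemma consecutive_left_unique I S S1 S2 a b a' b' :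
  consecutive I S1 S a b -> consecutive I S2 S a' b' ->
  [/\ S1 = S2, a = a' & b = b'].
Proof.
move=> c1 c2; have [d1 f1 e1] := consecutive_vertex c1.
have [d2 f2 e2] := consecutive_vertex c2.
case: c1 c2 => [F1 [cS ge _] det1 v1 _] [F2 _ det2 v2 _].
have [[x1 y1] [dz1 n1 z1]] := face_second_point F1 v1.
have [[x2 y2] [dz2 n2 z2]] := face_second_point F2 v2.
case: F1 F2 => [cS1 ge1 _] [cS2 ge2 _].
suff : [/\ a%:R = a'%:R :> R, b%:R = b'%:R :> R, fp S1 = fp S2 & fq S1 = fq S2].
  move=> [/eqP + /eqP + p12 q12]; rewrite !eqr_nat => /eqP aa /eqP bb; split=> //.
  case: S1 S2 p12 q12 f1 f2 {det1 det2 v1 v2 z1 z2 cS1 cS2 ge1 ge2} => [p q N] [p' q' N'] /=.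
  by move=> <- <- <- <-; rewrite aa bb.
have [] : [/\ b%:R = b'%:R :> R, a%:R = a'%:R :> R, fq S1 = fq S2 & fp S1 = fp S2]; last by split.
apply: (@next_face_unique R (fun y x => newton_diagram I (x, y))
  (fq S) (fp S) (fq S1) (fp S1) (fq S2) (fp S2) b%:R a%:R b'%:R a'%:R) => //.
- by rewrite coprime_sym.
- by rewrite mulnC [X in (_ < X)%N]mulnC.
- by rewrite coprime_sym.
- by rewrite mulnC [X in (_ < X)%N]mulnC.
- by rewrite -!natrM -!natrD addnC e1 addnC e2.
- by move=> x y /ge; rewrite /= -e1 natrD !natrM addrC [X in _ <= X]addrC.
- by move=> x y /ge1; rewrite /= -f1 natrD !natrM addrC [X in _ <= X]addrC.
- by move=> x y /ge2; rewrite /= -f2 natrD !natrM addrC [X in _ <= X]addrC.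
- exists y1, x1; split=> //; first by case=> yb xa; apply: n1; rewrite yb xa.
  by rewrite addrC z1 /= addrC.
- exists y2, x2; split=> //; first by case=> yb xa; apply: n2; rewrite yb xa.
  by rewrite addrC z2 /= addrC.
Qed.

Lemma consecutive_intro I S p q a b i j k l : is_face I S ->
  in_support I a b -> (fp S * a + fq S * b = fN S)%N ->
  coprime p q ->
  (forall al be, in_support I al be -> p * a + q * b <= p * al + q * be)%N ->
  in_support I k l -> (k <= i)%N -> (l <= j)%N -> (i, j) <> (a, b) ->
  (p * i + q * j = p * a + q * b)%N ->
  [/\ is_face I (Face p q (p * a + q * b)), face_set I S (a%:R, b%:R) &
      face_set I (Face p q (p * a + q * b)) (a%:R, b%:R)].
Proof.
move=> FS sab e cpq ge skl ki lj ne eij.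
have dab := diagram_support sab (leqnn _) (leqnn _).
split; try by split=> //=; apply/eqP; rewrite natr_line ?e.
exact: (lattice_face cpq ge (diagram_support skl ki lj) eij dab).
Qed.

Lemma next_face I S a b : is_face I S -> (0 < fp S)%N -> in_support I a b ->
  (fp S * a + fq S * b = fN S)%N ->
  (forall al be, in_support I al be -> fp S * al + fq S * be = fN S -> b <= be)%N ->
  exists S', consecutive I S S' a b.
Proof.
move=> FS p0 sab e end1.
have [||p [q [cpq det ge [i [j [k [l [skl ki lj ne eij]]]]]]]] :=
  next_face_exists sab p0 (q1 := fq S).
- by move=> i j sij; rewrite e (face_support_ge FS sij).
- by move=> i j sij; rewrite e; apply: end1.
exists (Face p q (p * a + q * b)).
by have [? ? ?] := consecutive_intro FS sab e cpq ge skl ki lj ne eij; split.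
Qed.

Lemma prev_face I S a b : is_face I S -> (0 < fq S)%N -> in_support I a b ->
  (fp S * a + fq S * b = fN S)%N ->
  (forall al be, in_support I al be -> fp S * al + fq S * be = fN S -> a <= al)%N ->
  exists S', consecutive I S' S a b.
Proof.
move=> FS q0 sab e end1.
have [||q [p [cpq det ge [j [i [l [k [skl lj ki ne eij]]]]]]]] :=
  @next_face_exists (fun be al => in_support I al be) b a (fq S) (fp S) sab q0.
- by move=> j i sij; rewrite addnC e addnC (face_support_ge FS sij).
- by move=> j i sij; rewrite addnC [X in _ = X]addnC e; apply: end1.
rewrite coprime_sym in cpq; rewrite addnC [X in _ = X]addnC in eij.
have {}ge al be : in_support I al be -> (p * a + q * b <= p * al + q * be)%N.
  by move=> /ge; rewrite addnC [X in (_ <= X)%N]addnC.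
have {}ne : (i, j) <> (a, b) by case=> ? ?; apply: ne; congr pair.
exists (Face p q (p * a + q * b)).
have [? ? ?] := consecutive_intro FS sab e cpq ge skl ki lj ne eij; split=> //=.
by rewrite mulnC [X in (_ < X)%N]mulnC.
Qed.

End Faces.

(** * The initial ideal and the Newton map *)

Section Series2.
Variable R : realType.
Local Notation C := R[i].
Implicit Types (f g h : series2 R) (I : seq (series2 R)).

Lemma coef2P f g : (forall i j, coef2 f i j = coef2 g i j) -> f = g.
Proof. exact: (@dcoefP C f g). Qed.

Lemma coef2_0 i j : coef2 (0 : series2 R) i j = 0.
Proof. exact: (@dcoef0 C). Qed.

Lemma coef2_sum (T : Type) (r : seq T) (P : pred T) (F : T -> series2 R) i j :
  coef2 (\sum_(k <- r | P k) F k) i j = \sum_(k <- r | P k) coef2 (F k) i j.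
Proof. exact: (@dcoef_sum C). Qed.

Lemma coef2M f g i j :
  coef2 (f * g) i j = \sum_(l < j.+1) \sum_(k < i.+1)
    coef2 f k l * coef2 g (i - k) (j - l).
Proof. exact: (@dcoefM C). Qed.

Lemma monom2E i j : (xx R ^+ i * yy R ^+ j : series2 R) = dmonom C i j.
Proof. by rewrite /dmonom fps_constX. Qed.

Lemma coef2_monomM k l f i j :
  coef2 (xx R ^+ k * yy R ^+ l * f) i j =
  if (k <= i)%N && (l <= j)%N then coef2 f (i - k) (j - l) else 0.
Proof. by rewrite monom2E; exact: (@dcoef_dmonomM C). Qed.

Lemma coef2_monom k l i j :
  coef2 (xx R ^+ k * yy R ^+ l) i j = ((i == k) && (j == l))%:R.
Proof. by rewrite monom2E; exact: (@dcoef_dmonom C). Qed.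

Lemma coef2_cstM c f i j : coef2 (cst2 c * f) i j = c * coef2 f i j.
Proof. by rewrite /coef2 coefs_constM coefs_constM. Qed.

Lemma mem_ideal I f : f \in I -> ideal I f.
Proof.
move=> fI; exists (fun i => (i == index f I)%:R).
have iI : (index f I < size I)%N by rewrite index_mem.
rewrite (bigD1 (Ordinal iI)) //= eqxx mul1r nth_index // big1 ?addr0 // => i.
by move=> ne; rewrite (_ : (_ == _ :> nat) = false) ?mul0r //; apply/negbTE.
Qed.

Lemma ideal1 g f : ideal [:: g] f -> exists c, f = c * g.
Proof. by case=> c ->; exists (c 0%N); rewrite big_ord1. Qed.

Definition vanishes_on (D : nat -> nat -> bool) f :=
  forall i j, D i j -> coef2 f i j = 0.

(** For a set D closed under passing to smaller exponents, the series without terms in D form an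
    ideal. *)
Lemma ideal_vanishes_on (D : nat -> nat -> bool) I f :
  (forall i j k l, (k <= i)%N -> (l <= j)%N -> D i j -> D k l) ->
  (forall g, g \in I -> vanishes_on D g) -> ideal I f -> vanishes_on D f.
Proof.
move=> Ddown IH [c ->] i j Dij; rewrite coef2_sum big1 // => n _.
rewrite coef2M big1 // => l _; rewrite big1 // => k _.
rewrite (IH _ (mem_nth _ _)) ?mulr0 //.
exact: (Ddown _ _ _ _ (leq_subr _ _) (leq_subr _ _) Dij).
Qed.

(** At the lowest weight N of g, every other term of f would need a term of g of weight below N. *)
Lemma coef2_lowestM (p q N : nat) f g i j : (0 < p)%N -> (0 < q)%N ->
  vanishes_on (fun i j => p * i + q * j < N)%N g -> (p * i + q * j = N)%N ->
  coef2 (f * g) i j = coef2 f 0 0 * coef2 g i j.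
Proof.
move=> p0 q0 van eij; rewrite coef2M (bigD1 ord0) //= (bigD1 ord0) //= !subn0.
rewrite [X in _ + X + _]big1 ?addr0 => [|k k0]; last first.
  have kp : (0 < p * k)%N by rewrite muln_gt0 p0 lt0n.
  have ki : (k <= i)%N by rewrite -ltnS.
  rewrite van ?mulr0 // -eij mulnBr.
  have : (p * k <= p * i)%N by rewrite leq_mul2l ki orbT.
  lia.
rewrite [X in _ + X]big1 ?addr0 // => l l0; rewrite big1 // => k _.
have ki : (k <= i)%N by rewrite -ltnS.
have lj : (l <= j)%N by rewrite -ltnS.
have lq : (0 < q * l)%N by rewrite muln_gt0 q0 lt0n.
rewrite van ?mulr0 // -eij !mulnBr.
have : (q * l <= q * j)%N by rewrite leq_mul2l lj orbT.
have : (p * k <= p * i)%N by rewrite leq_mul2l ki orbT.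
lia.
Qed.

(** Embeds C[y], so that powers of y + c can be treated by polynomial algebra. *)
Definition y_series (P : {poly C}) : series2 R := FPS (fun j => fps_const P`_j).

Lemma coef2_y_series P i j : coef2 (y_series P) i j = if i == 0%N then P`_j else 0.
Proof. by []. Qed.

Lemma y_seriesM P Q : y_series (P * Q) = y_series P * y_series Q.
Proof.
apply: coef2P => i j; rewrite coef2M coef2_y_series coefM.
case: i => [|i] /=; first by apply: eq_bigr => l _; rewrite big_ord1.
rewrite big1 // => l _; rewrite big1 // => k _; rewrite !coef2_y_series subn_eq0.
by case: k => -[|k] ki /=; rewrite ?mulr0 ?mul0r.
Qed.

Lemma y_seriesX P n : y_series (P ^+ n) = y_series P ^+ n.
Proof.
elim: n => [|n IH]; last by rewrite !exprS y_seriesM IH.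
rewrite !expr0; apply: fpsP => j; rewrite /= coef1; case: (j == 0%N) => //.
Qed.

Lemma y_series_XDC c : y_series ('X + c%:P) = yy R + cst2 c.
Proof.
apply: coef2P => i j; rewrite coef2_y_series coefD coefX coefC.
rewrite -[RHS]/(coef2 (yy R) i j + coef2 (cst2 c) i j).
have -> : coef2 (yy R) i j = ((i == 0%N) && (j == 1%N))%:R.
  by rewrite -coef2_monom expr0 expr1 mul1r.
have -> : coef2 (cst2 c) i j = if (i == 0%N) && (j == 0%N) then c else 0.
  by rewrite /coef2 /=; case: (j == 0%N) => /=; rewrite ?andbT ?andbF // if_same.
by case: i => [|i] /=; rewrite ?addr0.
Qed.

Definition at_x0 f : fps C := FPS (fun j => coef2 f 0 j).

Lemma at_x0M f g : at_x0 (f * g) = at_x0 f * at_x0 g.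
Proof.
by apply: fpsP => j; rewrite coefsM /= coef2M; apply: eq_bigr => l _; rewrite big_ord1.
Qed.

Lemma at_x0X f n : at_x0 (f ^+ n) = at_x0 f ^+ n.
Proof.
elim: n => [|n IH]; last by rewrite !exprS at_x0M IH.
by rewrite !expr0; apply: fpsP => -[|j].
Qed.

(** After division by x^M1 put x = 0: as h(0) = 0, only y^M2 remains. *)
Lemma coef2_base (M1 M2 : nat) (h : fps C) j : coefs h 0 = 0 ->
  coef2 (xx R ^+ M1 * (yy R + in_x h) ^+ M2) M1 j = (j == M2)%:R.
Proof.
move=> h0; rewrite -[xx R ^+ M1]mulr1 -(expr0 (yy R)) coef2_monomM leqnn leq0n subnn subn0 /=.
have -> : coef2 ((yy R + in_x h) ^+ M2) 0 j = coefs (at_x0 ((yy R + in_x h) ^+ M2)) j.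
  by [].
rewrite at_x0X (_ : at_x0 _ = fps_var C); last first.
  apply: fpsP => k; rewrite -[LHS]/(coef2 (yy R) 0 k + coef2 (in_x h) 0 k).
  have -> : coef2 (yy R) 0 k = (k == 1%N)%:R.
    by rewrite -[yy R]mul1r -(expr0 (xx R)) -[yy R]expr1 coef2_monom.
  by rewrite /coef2 /=; case: k => [|k] /=; rewrite ?h0 addr0.
rewrite -[fps_var C ^+ M2]mulr1 coefs_varXM coefs1 subn_eq0.
by case: leqP => H; [rewrite eqn_leq H andbT|rewrite ltn_eqF].
Qed.

(** The lexicographically least exponent is an invariant of the ideal, because the exponents below a
    given one form a set closed downwards. It is (N, e) for the given generators and (M1, M2) for
    the base generator. *)
Lemma base_ideal_exponents I M1 M2 N e : base_ideal I M1 M2 ->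
  (forall al be, in_support I al be -> N <= al)%N ->
  (forall be, in_support I N be -> e <= be)%N -> in_support I N e ->
  M1 = N /\ M2 = e.
Proof.
move=> [h [h0 eI]] lN le [f fI fNe].
set g := _ * _ in eI.
pose lex n m := fun i j : nat => (i < n)%N || (i == n) && (j < m)%N.
have lex_down n m i j k l : (k <= i)%N -> (l <= j)%N -> lex n m i j -> lex n m k l.
  by rewrite /lex; lia.
have gI : ideal I g by rewrite eI; apply: mem_ideal; rewrite inE.
have van f' : f' \in I -> vanishes_on (lex N e) f'.
  move=> f'I i j; rewrite /lex => /orP[iN|/andP[/eqP iN je]]; apply/eqP; apply: contraT => nz.
    by have := lN i j (ex_intro2 _ _ f' f'I nz); lia.
  by have := le j; rewrite -iN => /(_ (ex_intro2 _ _ f' f'I nz)); lia.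
have /negP h1 : ~ lex N e M1 M2.
  move=> H; have := ideal_vanishes_on (@lex_down N e) van gI H.
  by rewrite coef2_base // eqxx => /eqP; rewrite oner_eq0.
have vang g' : g' \in [:: g] -> vanishes_on (lex M1 M2) g'.
  rewrite inE => /eqP-> i j; rewrite /lex => /orP[iM|/andP[/eqP-> jM]].
    rewrite /g -[xx R ^+ M1]mulr1 -(expr0 (yy R)) coef2_monomM.
    by rewrite leqNgt iM.
  by rewrite coef2_base // ltn_eqF.
have /negP h2 : ~ lex M1 M2 N e.
  move=> H; have fg : ideal [:: g] f by rewrite -eI; exact: mem_ideal.
  by move/eqP: fNe; apply; apply: (ideal_vanishes_on (@lex_down M1 M2) vang fg H).
by move: h1 h2; rewrite /lex; lia.
Qed.

End Series2.

(** * The initial ideal of a face that is not dicritical *)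

Section FaceShape.
Variable R : realType.
Local Notation C := R[i].
Implicit Types (f g F : series2 R) (I : seq (series2 R)).

Lemma coef2_subst2 F (X Y : series2 R) al be :
  coef2 (subst2 F X Y) al be =
  \sum_(i < (al + be).+1) \sum_(j < (al + be).+1)
    coef2 F i j * coef2 (X ^+ i * Y ^+ j) al be.
Proof. by []. Qed.

Lemma coef2_subst_monom F p q al be : (0 < p)%N -> (0 < q)%N ->
  coef2 (subst2 F (xx R ^+ q) (yy R ^+ p)) al be =
  if (q %| al)%N && (p %| be)%N then coef2 F (al %/ q) (be %/ p) else 0.
Proof.
move=> p0 q0; rewrite coef2_subst2.
have E i j : coef2 ((xx R ^+ q) ^+ i * (yy R ^+ p) ^+ j) al be =
    ((al == q * i) && (be == p * j))%N%:R.
  by rewrite -!exprM coef2_monom.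
under eq_bigr do under eq_bigr do rewrite E.
case: ifP => [/andP[qal pbe]|H].
  have ai : (al %/ q < (al + be).+1)%N.
    by rewrite ltnS (leq_trans (leq_div _ _)) // leq_addr.
  have bj : (be %/ p < (al + be).+1)%N.
    by rewrite ltnS (leq_trans (leq_div _ _)) // leq_addl.
  rewrite (bigD1 (Ordinal ai)) //= (bigD1 (Ordinal bj)) //=.
  rewrite mulnC divnK // mulnC divnK // !eqxx mulr1.
  rewrite big1 ?addr0 => [|j jn]; last first.
    have -> : (be == p * j)%N = false; last by rewrite andbF mulr0.
    apply: contraNF jn => /eqP e; apply/eqP/val_inj => /=.
    exact: esym (etrans (congr1 (divn^~ p) e) (mulKn _ p0)).
  rewrite big1 ?addr0 // => i iN; rewrite big1 // => j _.
  have -> : (al == q * i)%N = false; last by rewrite mulr0.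
  apply: contraNF iN => /eqP e; apply/eqP/val_inj => /=.
  exact: esym (etrans (congr1 (divn^~ q) e) (mulKn _ q0)).
rewrite big1 // => i _; rewrite big1 // => j _.
case: eqP => [ei|_]; last by rewrite mulr0.
case: eqP => [ej|_]; last by rewrite mulr0.
have qal : (q %| al)%N by apply/dvdnP; exists i; rewrite mulnC -ei.
have pbe : (p %| be)%N by apply/dvdnP; exists j; rewrite mulnC -ej.
by rewrite qal pbe in H.
Qed.

Lemma subst2_1 (X Y : series2 R) : subst2 1 X Y = 1.
Proof.
have c1 i j : coef2 (1 : series2 R) i j = ((i == 0%N) && (j == 0%N))%:R.
  by rewrite -coef2_monom !expr0 mulr1.
apply: coef2P => al be; rewrite coef2_subst2.
under eq_bigr do under eq_bigr do rewrite c1.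
rewrite (bigD1 ord0) //= [X in _ + X]big1 ?addr0 => [|i i0]; last first.
  by apply: big1 => j _; rewrite (negPf (i0 : i != 0%N :> nat)) mul0r.
rewrite (bigD1 ord0) //= [X in _ + X]big1 ?addr0 => [|j j0]; last first.
  by rewrite (negPf (j0 : j != 0%N :> nat)) mul0r.
by rewrite mul1r !expr0 mulr1.
Qed.

Section Monomial.
Variables (p q a b : nat) (F : series2 R).
Hypotheses (p0 : (0 < p)%N) (q0 : (0 < q)%N).
Let G := xx R ^+ a * yy R ^+ b * subst2 F (xx R ^+ q) (yy R ^+ p).

Lemma coef2_quasi_hom i j : coef2 G (a + q * i) (b + p * j) = coef2 F i j.
Proof.
rewrite /G coef2_monomM !leq_addr !addKn coef2_subst_monom //.
by rewrite !dvdn_mulr // !mulKn.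
Qed.

Lemma coef2_quasi_hom_neq0 al be : coef2 G al be != 0 ->
  exists i j, [/\ al = (a + q * i)%N, be = (b + p * j)%N & coef2 F i j != 0].
Proof.
rewrite /G coef2_monomM coef2_subst_monom //.
case: ifP => [/andP[aal bbe]|_]; last by rewrite eqxx.
case: ifP => [/andP[/dvdnP[i ei] /dvdnP[j ej]]|_]; last by rewrite eqxx.
rewrite ei ej !mulnK // => nz; exists i, j; split=> //.
  by rewrite mulnC -ei subnKC.
by rewrite mulnC -ej subnKC.
Qed.

End Monomial.

Lemma homogeneous_not_divides_y e F :
  homogeneous e F -> ~ divides (yy R) F -> coef2 F e 0 != 0.
Proof.
move=> hom; apply: contra_notN => /eqP Fe0.
exists (FPS (fun j => coefs F j.+1)); apply: fpsP => j.
rewrite -[yy R]/(fps_var _ ^+ 1) coefs_varXM; case: j => [|j] /=; last by rewrite subn1.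
apply: fpsP => i; rewrite -[LHS]/(coef2 F i 0).
have [->|ie] := eqVneq i e; first by rewrite Fe0 /= if_same.
by rewrite hom ?addn0 //= if_same.
Qed.

(* The initial ideal is generated by [x^a y^b F(x^q, y^p)], read off coefficientwise:
   its value at the upper endpoint is the multiplier of each generator. *)
Definition shape I (S : face) (a b e : nat) F :=
  [/\ (fp S * a + fq S * b + fp S * fq S * e = fN S)%N,
      [/\ homogeneous e F, coef2 F 0 e = 1 & coef2 F e 0 != 0],
      in_support I a (b + fp S * e),
      forall f, f \in I -> forall i j, (i + j = e)%N ->
        coef2 f (a + fq S * i) (b + fp S * j) =
        coef2 f a (b + fp S * e) * coef2 F i j &
      forall al be, in_support I al be -> (fp S * al + fq S * be = fN S)%N ->
        exists i j, [/\ al = (a + fq S * i)%N, be = (b + fp S * j)%N & (i + j = e)%N]].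

(** The generator G is quasi-homogeneous, so each part of a generator, being c G, equals c(0, 0) G.
    As G has coefficient 1 at the upper endpoint, c(0, 0) is the coefficient of the generator
    there. *)
Lemma principal_shape I S a b e F d : compact_face I S ->
  face_decomposition I S a b e F d [:: 1] -> shape I S a b e F.
Proof.
move=> [FS p0 q0] [[hom F0e _ ndy] _ /=]; rewrite subst2_1 mulr1.
set G := _ * _ => eI.
have Fe0 := homogeneous_not_divides_y hom ndy.
set p := fp S in p0 G eI *; set q := fq S in q0 G eI *; set N := fN S.
set M := (p * a + q * b + p * q * e)%N.
have Gw al be : coef2 G al be != 0 -> (p * al + q * be = M)%N.
  move=> /(coef2_quasi_hom_neq0 p0 q0)[i [j [-> -> Fij]]].
  have ij : (i + j = e)%N by apply/eqP; apply: contraT => /hom e0; rewrite e0 eqxx in Fij.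
  by rewrite /M -ij; lia.
have Gvan : vanishes_on (fun i j => p * i + q * j < M)%N G.
  by move=> i j lt; apply/eqP; apply: contraT => /Gw e'; rewrite e' ltnn in lt.
have G1 : coef2 G a (b + p * e) = 1.
  by rewrite -F0e -(coef2_quasi_hom a b F p0 q0) muln0 addn0.
have partE f al be : coef2 (part S f) al be =
    if (p * al + q * be == N)%N then coef2 f al be else 0 by [].
have partG f : f \in I -> exists c, part S f = c * G.
  by move=> fI; apply: ideal1; rewrite -eI; apply: mem_ideal; apply: map_f.
have [c eG] : ideal (initial_ideal I S) G.
  by rewrite eI; apply: mem_ideal; rewrite inE.
have size_part : size (initial_ideal I S) = size I by rewrite size_map.
have partvan g : g \in initial_ideal I S ->
    vanishes_on (fun i j => p * i + q * j < N)%N g.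
  by move=> /mapP[f fI ->] i j lt; rewrite partE ltn_eqF.
have [f0 f0I [al0 [be0 [e0 nz0]]]] : exists2 f, f \in I & exists al be,
    (p * al + q * be = N)%N /\ coef2 f al be != 0.
  apply: contrapT => none; suff G0 : coef2 G a (b + p * e) = 0.
    by move: G1; rewrite G0 => /eqP; rewrite eq_sym oner_eq0.
  rewrite eG coef2_sum big1 // => -[i ip] _ /=.
  rewrite (_ : nth 0 _ i = 0) ?mulr0 ?coef2_0 //.
  have : nth 0 (initial_ideal I S) i \in initial_ideal I S by apply: mem_nth.
  move=> /mapP[f fI ->]; apply: coef2P => al be; rewrite coef2_0 partE.
  case: eqP => // eN; apply/eqP; apply: contraT => nz.
  by case: none; exists f => //; exists al, be.
(* The weight M of G is the weight N of the face: both are the lowest weight in the same nonzero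
   ideal. *)
have NM : N = M.
  apply/eqP; rewrite eqn_leq; apply/andP; split; rewrite leqNgt; apply/negP => lt.
    have : coef2 G a (b + p * e) = 0.
      have van : vanishes_on (fun i j => p * i + q * j < N)%N G.
        apply: ideal_vanishes_on partvan _; last by exists c.
        move=> i j k l ki lj; apply: leq_ltn_trans.
        by rewrite leq_add // leq_mul2l ?ki ?lj orbT.
      by apply: van; move: lt; rewrite /M; lia.
    by rewrite G1 => /eqP; rewrite oner_eq0.
  have [c0 ec0] := partG _ f0I.
  have : coef2 (part S f0) al0 be0 = 0.
    have van : vanishes_on (fun i j => p * i + q * j < M)%N (part S f0).
      apply: (ideal_vanishes_on (I := [:: G])); last by rewrite -eI; apply/mem_ideal/map_f.
        move=> i j k l ki lj; apply: leq_ltn_trans.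
        by rewrite leq_add // leq_mul2l ?ki ?lj orbT.
      by move=> g; rewrite inE => /eqP->.
    by apply: van; rewrite e0.
  by rewrite partE e0 eqxx => /eqP; rewrite (negPf nz0).
have partC f : f \in I -> forall al be, (p * al + q * be = N)%N ->
    coef2 f al be = coef2 f a (b + p * e) * coef2 G al be.
  move=> fI; have [c0 ec0] := partG _ fI.
  have main al be : (p * al + q * be = N)%N -> coef2 f al be = coef2 c0 0 0 * coef2 G al be.
    move=> eN; rewrite -(coef2_lowestM c0 p0 q0 Gvan) -?NM // -ec0 partE.
    by rewrite eN eqxx.
  move=> al be /main ->; rewrite (main a (b + p * e)%N) ?G1 ?mulr1 //.
  by rewrite NM /M; lia.
split=> //.
- exists f0 => //; apply: contraNneq nz0 => fz.
  by rewrite (partC _ f0I) // fz mul0r.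
- move=> f fI i j ij; rewrite (partC f fI) ?coef2_quasi_hom //.
  by rewrite NM /M -ij; lia.
- move=> al be [f fI nz] eN.
  have : coef2 G al be != 0.
    by move: nz; rewrite (partC _ fI) //; apply: contraNneq => ->; rewrite mulr0.
  move=> /(coef2_quasi_hom_neq0 p0 q0)[i [j [-> -> Fij]]]; exists i, j; split=> //.
  by apply/eqP; apply: contraT => /hom e1; rewrite e1 eqxx in Fij.
Qed.

Lemma shape_right_corner I S a b e F :
  shape I S a b e F -> in_support I (a + fq S * e) b.
Proof.
move=> [_ [_ _ nz] [f fI fnz] parts _]; exists f => //.
by have := parts f fI e 0%N (addn0 _); rewrite muln0 addn0 => ->; rewrite mulf_neq0.
Qed.

(** On the face, a is the least abscissa and b the least ordinate of the support, and F is read off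
    from ratios to the coefficient at the upper endpoint. Decompositions are only asserted to exist,
    so this is what makes the roots and their number independent of the choice. *)
Lemma shape_unique I S a b e F a' b' e' F' : compact_face I S ->
  shape I S a b e F -> shape I S a' b' e' F' ->
  [/\ a = a', b = b', e = e' & F = F'].
Proof.
move=> [_ p0 q0] sh sh'; have c1 := shape_right_corner sh.
have c2 := shape_right_corner sh'.
case: sh sh' => [eN [hom _ _] sup parts ends] [eN' [hom' _ _] sup' parts' ends'].
have [i1 [j1 [ai1 bj1 _]]] := ends' _ _ sup ltac:(by rewrite -eN; lia).
have [i2 [j2 [ai2 bj2 _]]] := ends _ _ sup' ltac:(by rewrite -eN'; lia).
have [i3 [j3 [ai3 bj3 _]]] := ends' _ _ c1 ltac:(by rewrite -eN; lia).
have [i4 [j4 [ai4 bj4 _]]] := ends _ _ c2 ltac:(by rewrite -eN'; lia).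
have ea : a = a' by apply/eqP; rewrite eqn_leq {1}ai2 ai1 !leq_addr.
have eb : b = b' by apply/eqP; rewrite eqn_leq {1}bj4 bj3 !leq_addr.
rewrite -ea -eb in eN' parts' *.
have ee : e = e'.
  apply/eqP; rewrite -(eqn_pmul2l (_ : 0 < fp S * fq S)%N) ?muln_gt0 ?p0 //.
  by rewrite -(eqn_add2l (fp S * a + fq S * b)) eN eN'.
rewrite -ee in hom' parts' *; split=> //; apply: coef2P => i j.
have [ij|/eqP ij] := eqVneq (i + j)%N e; last by rewrite hom ?hom' //; apply/eqP.
case: sup => f fI fnz; apply: (mulfI fnz).
by rewrite -(parts f) // -(parts' f).
Qed.

End FaceShape.

(** * Faces with one root and their Newton map *)

Section OneRoot.
Variable R : realType.
Local Notation C := R[i].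
Implicit Types (f g F : series2 R) (I : seq (series2 R)) (S : face).

Lemma nondicritical_shape I S e F : compact_face I S -> ~ dicritical I S ->
  face_polynomial I S e F -> exists a b, shape I S a b e F.
Proof.
move=> cS nd [a [b [d [ks dec]]]]; exists a, b.
have [_ [[ksE _]|[_ d1 _ _]] _] := dec.
  by apply: (principal_shape cS (d := d)); rewrite -ksE.
by case: nd; exists a, b, e, F, d, ks.
Qed.

Lemma monic_one_root (P : {poly C}) (e : nat) (mu : C) :
  P \is monic -> size P = e.+1 -> (forall z, root P z -> z = mu) ->
  P = ('X - mu%:P) ^+ e.
Proof.
move=> mP sP rP; have [rs eP] := closed_field_poly_normal P.
rewrite (monicP mP) scale1r in eP.
have rsmu : all (pred1 mu) rs.
  by apply/allP => z zrs; apply/eqP/rP; rewrite eP root_prod_XsubC.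
have srs : size rs = e.
  by apply/eqP; rewrite -eqSS -sP eP size_prod_XsubC.
by rewrite eP (all_pred1P _ _ rsmu) big_nseq iter_mulr mulr1 srs.
Qed.

Lemma one_root_face I S : compact_face I S -> ~ dicritical I S ->
  root_number I S 1 -> exists a b e F mu,
  [/\ shape I S a b e F, (0 < e)%N /\ mu != 0,
      forall k, (k <= e)%N -> coef2 F (e - k) k = (('X - mu%:P) ^+ e)`_k,
      forall mu', face_root I S mu' <-> mu' = mu &
      forall r, root_number I S r -> r = 1%N].
Proof.
move=> cS nd [e [F [s [fpF us ss sP]]]].
have [a [b shF]] := nondicritical_shape cS nd fpF.
have [mu es] : exists mu, s = [:: mu] by case: s ss {us sP} => [|mu []] //; exists mu.
have muP mu' : is_root e F mu' <-> mu' = mu.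
  by rewrite -sP es inE; split=> /eqP.
have [mu0 rmu] : is_root e F mu by apply/muP.
have [_ [_ F0e Fe0] _ _ _] := shF.
(* This is F(1, y): monic of degree e, and nonzero at 0 because y does not divide F. Its only
   complex root is therefore mu. *)
pose P := \poly_(k < e.+1) coef2 F (e - k) k.
have Pe : P`_e = 1 by rewrite coef_poly ltnSn subnn.
have sizeP : size P = e.+1.
  by apply: size_poly_eq; rewrite subnn F0e oner_neq0.
have mP : P \is monic by rewrite monicE lead_coefE sizeP Pe.
have evP z : P.[z] = \sum_(k < e.+1) coef2 F (e - k) k * z ^+ k.
  by rewrite horner_poly.
have eP : P = ('X - mu%:P) ^+ e.
  apply: monic_one_root => // z /rootP; rewrite evP => rz; apply/muP; split=> //.
  apply: contraNneq Fe0 => z0; move: rz; rewrite z0 big_ord_recl big1 ?addr0.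
    by rewrite subn0 mulr1 => ->.
  by move=> k _; rewrite expr0n mulr0.
have uniqF e' F' : face_polynomial I S e' F' -> e' = e /\ F' = F.
  move=> /(nondicritical_shape cS nd)[a' [b' sh']].
  by have [_ _ -> ->] := shape_unique cS sh' shF.
exists a, b, e, F, mu; split=> //.
- split=> //; case: (posnP e) => // e0; move: rmu; rewrite -evP eP e0.
  by rewrite expr0 hornerC => /eqP; rewrite oner_eq0.
- by move=> k ke; rewrite -eP coef_poly ltnS ke.
- move=> mu'; split; first by move=> [e' [F' [/uniqF[-> ->] /muP]]].
  by move=> ->; exists e, F; split.
- move=> r [e' [F' [s' [/uniqF[-> ->] us' <- s'P]]]].
  rewrite -ss; apply/perm_size/uniq_perm => // z.
  by apply/idP/idP => [/s'P/sP|/sP/s'P].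
Qed.

Lemma sum_pick (V : nmodType) (n x y : nat) (G : nat -> nat -> V) :
  (x < n)%N -> (y < n)%N ->
  \sum_(i < n) \sum_(j < n) (if (i == x :> nat) && (j == y :> nat) then G i j else 0)
  = G x y.
Proof.
move=> xn yn; rewrite (bigD1 (Ordinal xn)) //= [X in _ + X]big1 ?addr0 => [|i ix].
  rewrite (bigD1 (Ordinal yn)) //= !eqxx big1 ?addr0 // => j jy.
  by rewrite (negPf (jy : j != y :> nat)) ?andbF.
by apply: big1 => j _; rewrite (negPf (ix : i != x :> nat)).
Qed.

Lemma coef2_newton_map p q p' q' (mu : C) f al be :
  coef2 (newton_map p q p' q' mu f) al be =
  \sum_(i < (al + be).+1) \sum_(j < (al + be).+1)
    coef2 f i j * (if (al == p * i + q * j)%N then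
      mu ^+ (q' * i) * (('X + (mu ^+ p')%:P) ^+ j)`_be else 0).
Proof.
rewrite coef2_subst2; apply: eq_bigr => i _; apply: eq_bigr => j _; congr (_ * _).
have cstX (c : C) n : cst2 c ^+ n = cst2 (c ^+ n).
  by rewrite /cst2 !fps_constX.
rewrite !exprMn cstX -!exprM -y_series_XDC -y_seriesX -!mulrA coef2_cstM.
rewrite mulrA -exprD -[xx R ^+ _]mulr1 -(expr0 (yy R)) coef2_monomM leq0n subn0 andbT.
rewrite coef2_y_series [(q * j)%N]mulnC subn_eq0 eqn_leq.
by case: leqP => H1; case: leqP => H2 //=; rewrite ?mulr0.
Qed.

(** On the face every generator is a multiple of x^a y^b (y^p - mu x^q)^e, which the Newton map
    sends to x^N u^a Y^b (Y^p - m^p)^e with Y = y + m. Support points off the face have larger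
    weight and do not reach x^N. *)
Lemma newton_map_corner I S a b e F mu p' q' :
  compact_face I S -> shape I S a b e F -> mu != 0 ->
  (forall k, (k <= e)%N -> coef2 F (e - k) k = (('X - mu%:P) ^+ e)`_k) ->
  newton_exponents (fp S) (fq S) p' q' ->
  let I' := [seq newton_map (fp S) (fq S) p' q' mu f | f <- I] in
  [/\ forall al be, in_support I' al be -> (fN S <= al)%N,
      forall be, in_support I' (fN S) be -> (e <= be)%N &
      in_support I' (fN S) e].
Proof.
move=> [FS p0 q0] [eN [hom _ _] sup parts ends] mu0 FX [epq _ _] I'.
set p := fp S in p0 eN sup parts ends epq I' *.
set q := fq S in q0 eN parts ends epq I' *; set N := fN S in eN ends *.
pose m := mu ^+ p'; pose Y : {poly C} := 'X + m%:P; pose u := mu ^+ q'.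
(* The cofactor of y^e: Y^p - m^p is y times the inner sum, whose value p m^(p-1) at y = 0 is
   nonzero in characteristic 0. *)
pose U := u ^+ a *: (Y ^+ b * (\sum_(i < p) Y ^+ (p.-1 - i) * m%:P ^+ i) ^+ e).
have U0 : U.[0] != 0.
  rewrite /U hornerZ hornerM !horner_exp horner_sum hornerD hornerX hornerC add0r.
  rewrite (eq_bigr (fun=> m ^+ p.-1)); last first.
    move=> i _; rewrite hornerM -!polyC_exp horner_exp hornerD hornerX !hornerC add0r.
    by rewrite -exprD subnK // -ltnS prednK.
  rewrite sumr_const card_ord -mulr_natr.
  have mz : m != 0 by rewrite expf_neq0.
  have uz : u != 0 by rewrite expf_neq0.
  by rewrite !(mulf_neq0, expf_neq0) // pnatr_eq0 -lt0n.
have polyE : \sum_(k < e.+1) (('X - mu%:P) ^+ e)`_k *: (u ^+ (a + q * (e - k)) *: Y ^+ (b + p * k))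
    = 'X^e * U.
  have coefXsub k : (k <= e)%N -> (('X - mu%:P) ^+ e)`_k = (- mu) ^+ (e - k) *+ 'C(e, k).
    move=> ke; rewrite addrC -polyCN exprDn coef_sum (bigD1 (Ordinal (_ : k < e.+1)%N)) //=.
    rewrite coefMn -polyC_exp coefCM coefXn eqxx mulr1 big1 ?addr0 // => i ik.
    rewrite coefMn -polyC_exp coefCM coefXn (_ : (k == i :> nat) = false).
      by rewrite mulr0 mul0rn.
    by apply/negbTE; rewrite eq_sym.
  have -> : 'X^e * U = u ^+ a *: (Y ^+ b * (Y ^+ p - (m ^+ p)%:P) ^+ e).
    rewrite /U -scalerAr mulrCA; congr (_ *: (_ * _)).
    rewrite -exprMn; congr (_ ^+ _); rewrite polyC_exp subrXX.
    by rewrite /Y addrK; congr (_ * _); apply: eq_bigr => i _; rewrite -subn1 -subnDA add1n.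
  (* This is the relation p p' = 1 + q q' of the Newton exponents. *)
  have -> : m ^+ p = mu * u ^+ q.
    by rewrite /m /u -!exprM -exprS; congr (_ ^+ _); rewrite mulnC epq mulnC.
  rewrite -[in RHS]polyCN [Y ^+ p + _]addrC [(_ + Y ^+ p) ^+ e]exprDn mulr_sumr scaler_sumr; apply: eq_bigr => k _.
  have ke : (k <= e)%N by rewrite -ltnS.
  rewrite coefXsub // -polyC_exp mul_polyC scalerMnl -scalerAr !scalerA.
  rewrite -[(Y ^+ p) ^+ k]exprM -[Y ^+ b * _]exprD; congr (_ *: _).
  rewrite -mulNr exprMn -[(u ^+ q) ^+ _]exprM [u ^+ (_ + _)]exprD.
  by rewrite mulrnAl mulrnAr; congr (_ *+ _); ring.
have coefN f be : f \in I -> coef2 (newton_map p q p' q' mu f) N be =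
    coef2 f a (b + p * e) * ('X^e * U)`_be.
  move=> fI; set t := coef2 f a (b + p * e).
  pose Q k := (('X - mu%:P) ^+ e)`_k.
  pose G k (i j : nat) := t * Q k * (u ^+ i * (Y ^+ j)`_be).
  have partk k : (k <= e)%N -> coef2 f (a + q * (e - k)) (b + p * k) = t * Q k.
    by move=> ke; rewrite parts ?subnK // FX.
  have weight k : (k <= e)%N -> (p * (a + q * (e - k)) + q * (b + p * k) = N)%N.
    by move=> ke; rewrite -eN -{2}(subnK ke); lia.
  (* Weight N is reached only on the face, where [ends] lists the support by k = 0, ..., e; any
     other pair has coefficient zero or a different weight. *)
  have termE i j : coef2 f i j * (if (N == p * i + q * j)%N then
      mu ^+ (q' * i) * (Y ^+ j)`_be else 0) =
      \sum_(k < e.+1) (if (i == a + q * (e - k))%N && (j == b + p * k)%N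
                        then G k i j else 0).
    have [[k0 [/= ke0 ei ej]]|none] := pselect (exists k,
        [/\ (k <= e)%N, i = a + q * (e - k) & j = b + p * k]%N).
      rewrite (bigD1 (Ordinal (ke0 : k0 < e.+1)%N)) //= ei ej !eqxx big1 ?addr0; last first.
        move=> k kk0; rewrite [X in _ && X](_ : _ = false) ?andbF //.
        apply: contraNF kk0; rewrite eqn_add2l eqn_pmul2l // => /eqP kk.
        exact/eqP/val_inj.
      by rewrite weight // eqxx partk // exprM.
    rewrite [RHS]big1; last first.
      move=> k _; case: ifP => // /andP[/eqP ei /eqP ej]; case: none.
      by exists k; split=> //; rewrite -ltnS.
    case: eqP => [eNij|_]; last by rewrite mulr0.
    have [->|nz] := eqVneq (coef2 f i j) 0; first by rewrite mul0r.
    have [i' [j' [ei ej ij]]] := ends i j (ex_intro2 _ _ f fI nz) (esym eNij).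
    by case: none; exists j'; split; rewrite -?ij ?leq_addl ?addnK.
  rewrite coef2_newton_map.
  under eq_bigr do under eq_bigr do rewrite termE.
  under eq_bigr do rewrite exchange_big.
  rewrite exchange_big /= -polyE coef_sum mulr_sumr; apply: eq_bigr => k _.
  have ke : (k <= e)%N by rewrite -ltnS.
  have bx : (a + q * (e - k) < (N + be).+1)%N.
    by rewrite ltnS -(weight _ ke) -addnA (leq_trans (leq_pmull _ p0)) ?leq_addr.
  have bY : (b + p * k < (N + be).+1)%N.
    rewrite ltnS -(weight _ ke) addnAC (leq_trans (leq_pmull _ q0)) //.
    by rewrite leq_addl.
  by rewrite (sum_pick (G k) bx bY) /G /Q !coefZ !mulrA.
split.
- move=> al be [_ /mapP[f fI ->]]; apply: contraR; rewrite -ltnNge => alN.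
  rewrite coef2_newton_map big1 // => i _; rewrite big1 // => j _.
  case: eqP => [e1|_]; last by rewrite mulr0.
  have [->|nz] := eqVneq (coef2 f i j) 0; first by rewrite mul0r.
  by have := face_support_ge FS (ex_intro2 _ _ f fI nz); rewrite -/p -/q -/N; lia.
- move=> be [_ /mapP[f fI ->]]; rewrite coefN // coefXnM; case: ltnP => //.
  by rewrite mulr0 eqxx.
- case: sup => f fI nz; exists (newton_map p q p' q' mu f); first exact: map_f.
  by rewrite coefN // coefXnM ltnn subnn -horner_coef0 mulf_neq0.
Qed.

End OneRoot.

(** * The terms containing the factor of the face *)

Section Enumeration.
Variables (R : realType) (I0 : seq (series2 R)) (nu0 : nat) (S : face).
Local Notation C := R[i].
Local Notation stage := (stage I0 nu0).
Local Notation occurs := (occurs I0 nu0).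

Lemma stage_nil I nu : stage [::] I nu -> I = I0 /\ nu = nu0.
Proof. by move=> st; inversion st. Qed.

Lemma stage_one S' mu I nu : stage [:: (S', mu)] I nu ->
  exists p' q', [/\ face_root I0 S' mu, newton_exponents (fp S') (fq S') p' q',
    I = [seq newton_map (fp S') (fq S') p' q' mu f | f <- I0] &
    nu = (fp S' * nu0 + fq S')%N].
Proof.
move=> st; inversion st as [|pi I' nu' S'' mu' p' q' st' _ _ rt ne]; subst.
by have [? ?] := stage_nil st'; subst; exists p', q'.
Qed.

(** With p = 1 or q = 1 the exponents are forced, so a root determines the ideal of the next
    stage. *)
Lemma newton_exponents_axis p q p' q' : (0 < q)%N -> p = 1%N \/ q = 1%N ->
  newton_exponents p q p' q' <-> p' = 1%N /\ q' = p.-1 /\ (0 < p)%N.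
Proof.
move=> q0 pq; split=> [[e pq' qp]|[-> [-> p0]]].
  case: pq => e1; subst.
    by move: e qp; rewrite mul1n ltnS leqn0 => -> /eqP->; rewrite muln0.
  case: p' pq' e => [|[|]] //; first by rewrite muln0.
  by rewrite muln1 mul1n => _ ->; rewrite add1n.
by split=> //; [case: pq => ->; rewrite ?muln1 ?muln0 ?mul1n ?add1n ?prednK
               |rewrite prednK].
Qed.

Definition term_path (t : zeta_term R) : stage_path R :=
  match t with
  | VertexTerm pi _ _ _ _ _ => pi
  | FaceTerm pi _ _ _ => pi
  | BaseTerm pi _ _ _ => pi
  end.

(** Beyond the first stage every label has a nonempty path, except that of the vertical face after
    exactly one Newton map. *)
Lemma face_label_vertical (pi : stage_path R) S' : pi <> [::] -> face_label pi S' = ([::], S) ->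
  exists mu, [/\ pi = [:: (S, mu)], fp S' = 1%N & fq S' = 0%N].
Proof.
case: pi => [//|[S'' mu] pi] _ /=; case: ifP => // /andP[/eqP-> /eqP->] [-> ->].
by exists mu.
Qed.

Lemma contains_cons1 (pi : stage_path R) nu S1 (t : zeta_term R) :
  denominator t = [:: face_factor pi nu S1] ->
  contains_factor_of S t <-> face_label pi S1 = ([::], S).
Proof. by rewrite /contains_factor_of => -> /=; rewrite inE eq_sym; split=> /eqP. Qed.

Lemma contains_cons2 (pi : stage_path R) nu S1 S2 (t : zeta_term R) :
  denominator t = [:: face_factor pi nu S1; face_factor pi nu S2] ->
  contains_factor_of S t <->
  face_label pi S1 = ([::], S) \/ face_label pi S2 = ([::], S).
Proof.
rewrite /contains_factor_of => -> /=; rewrite !inE ![([::], S) == _]eq_sym.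
by split=> [/orP[]/eqP|[]/eqP->]; [left|right| |rewrite orbT].
Qed.

Hypothesis cS : compact_face I0 S.

Section FirstStage.
Variables (Sl Sr : face) (al bl ar br : nat).
Hypotheses (cl : consecutive I0 Sl S al bl) (cr : consecutive I0 S Sr ar br).
Hypotheses (r1 : root_number I0 S 1) (rr : forall r, root_number I0 S r -> r = 1%N).

Definition first_terms : seq (zeta_term R) :=
  [:: VertexTerm [::] nu0 Sl S al bl; VertexTerm [::] nu0 S Sr ar br;
      FaceTerm [::] nu0 S 1].

Lemma first_termsP t : t \in first_terms <->
  [/\ occurs t, contains_factor_of S t & term_path t = [::]].
Proof.
have st0 := stage_init I0 nu0; have ex0 : expanded [::] I0 by left.
split.
  rewrite !inE => /or3P[]/eqP->; split=> //.
  - exact: occurs_vertex st0 ex0 cl.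
  - by apply/(contains_cons2 (pi := [::]) (nu := nu0) (S1 := Sl) (S2 := S)); [|right].
  - exact: occurs_vertex st0 ex0 cr.
  - by apply/(contains_cons2 (pi := [::]) (nu := nu0) (S1 := S) (S2 := Sr)); [|left].
  - exact: occurs_face st0 ex0 cS r1.
  - by apply/(contains_cons1 (pi := [::]) (nu := nu0) (S1 := S)).
case; case=> [pi I nu S1 S2 a b st _ c|pi I nu S' r st _ c rn|pi I nu M1 M2 _ nex _] ct /= e.
- rewrite {}e in st ct *; have [? ?] := stage_nil st; subst I nu.
  move/contains_cons2: ct => /(_ _ _ _ _ erefl) [] [e]; subst.
    by have [-> -> ->] := consecutive_right_unique c cr; rewrite /first_terms !inE eqxx orbT.
  by have [-> -> ->] := consecutive_left_unique c cl; rewrite /first_terms !inE eqxx.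
- rewrite {}e in st ct *; have [? ?] := stage_nil st; subst I nu.
  move/contains_cons1: ct => /(_ _ _ _ erefl) [e]; subst.
  by rewrite (rr rn) /first_terms !inE eqxx !orbT.
- by case: nex; left.
Qed.

Lemma first_terms_uniq : uniq first_terms.
Proof.
rewrite /= !inE /= !andbT; apply/andP; split; last by apply/eqP.
apply/norP; split; apply/eqP => // -[e _ _ _].
by case: cl => _ _ + _ _; rewrite e ltnn.
Qed.

End FirstStage.

Section SecondStage.
Variables (a b e : nat) (F : series2 R) (mu : C).
Hypotheses (shF : shape I0 S a b e F) (mu0 : mu != 0).
Hypothesis FX : forall k, (k <= e)%N -> coef2 F (e - k) k = (('X - mu%:P) ^+ e)`_k.
Hypothesis rootS : forall mu', face_root I0 S mu' <-> mu' = mu.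
Hypothesis axis : fp S = 1%N \/ fq S = 1%N.

Let N := fN S.
Let nu1 := (fp S * nu0 + fq S)%N.
Let I1 := [seq newton_map (fp S) (fq S) 1 (fp S).-1 mu f | f <- I0].

Let p0 : (0 < fp S)%N. Proof. by case: cS. Qed.
Let q0 : (0 < fq S)%N. Proof. by case: cS. Qed.

Let ne1 : newton_exponents (fp S) (fq S) 1 (fp S).-1.
Proof. by apply/newton_exponents_axis. Qed.

Lemma second_stage mu' I nu : stage [:: (S, mu')] I nu ->
  [/\ mu' = mu, I = I1 & nu = nu1].
Proof.
case/stage_one=> p' [q' [/rootS-> /(newton_exponents_axis _ _ q0 axis) ne -> ->]].
by case: ne => -> [-> _].
Qed.

Lemma second_stageP : stage [:: (S, mu)] I1 nu1.
Proof.
by apply: stage_next (stage_init I0 nu0) _ cS _ ne1; [left|apply/rootS].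
Qed.

Lemma vertical_face : is_face I1 (Face 1 0 N).
Proof.
have [geN _ sN] := newton_map_corner cS shF mu0 FX ne1.
apply: (@lattice_face _ _ 1 0 N N e N e.+1) => //.
- by move=> al be /geN; rewrite mul1n mul0n addn0.
- exact: diagram_support sN _ _.
- by rewrite mul1n mul0n addn0.
- exact: diagram_support sN _ _.
- by rewrite mul1n mul0n addn0.
- by case; lia.
Qed.

(** [face_label] looks only at (p, q), so the constant of the vertical line has to be recovered as
    the least abscissa. *)
Lemma vertical_face_unique N' : is_face I1 (Face 1 0 N') -> N' = N.
Proof.
move=> Fv; have [geN _ sN] := newton_map_corner cS shF mu0 FX ne1.
have := face_support_ge Fv sN; rewrite /= mul1n mul0n addn0 => le.
case: Fv => _ _ [z [_ [_ [dz ez] _]]]; apply/eqP; rewrite eqn_leq le /=.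
have := diagram_ge (p := 1) (q := 0) (N := N) _ dz.
rewrite ez ler_nat; apply=> al be /geN.
by rewrite mul1n mul0n addn0.
Qed.

(** At a later stage the label of S belongs to the vertical face only. That face is not compact and
    cannot be the right member of a pair, which leaves these two forms. *)
Lemma second_stage_term t : occurs t -> contains_factor_of S t ->
  term_path t <> [::] ->
  (exists S2 a' b', [/\ t = VertexTerm [:: (S, mu)] nu1 (Face 1 0 N) S2 a' b',
     expanded [:: (S, mu)] I1 & consecutive I1 (Face 1 0 N) S2 a' b']) \/
  (exists M1 M2, [/\ t = BaseTerm [:: (S, mu)] nu1 M1 M2,
     ~ expanded [:: (S, mu)] I1 & base_ideal I1 M1 M2]).
Proof.
have vertical pi I nu S' : stage pi I nu -> pi <> [::] ->
    face_label pi S' = ([::], S) ->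
    [/\ pi = [:: (S, mu)], I = I1, nu = nu1 & S' = Face 1 0 (fN S')].
  move=> st pin /face_label_vertical[]// mu' [epi p1 q1].
  rewrite epi in st *; have [-> -> ->] := second_stage st; split=> //.
  by case: S' p1 q1 => ? ? ? /= -> ->.
case=> [pi I nu S1 S2 a' b' st ex c|pi I nu S' r st ex c rn|
        pi I nu M1 M2 st nex bM] ct /= pin.
- have [/(vertical _ _ _ _ st pin)|/(vertical _ _ _ _ st pin)] :
      face_label pi S1 = ([::], S) \/ face_label pi S2 = ([::], S).
  + exact/(contains_cons2 (nu := nu) (t := VertexTerm pi nu S1 S2 a' b')).
  + case=> epi eI enu e1; left; exists S2, a', b'; subst pi I nu; rewrite e1 in c *.
    by have <- : fN S1 = N; [case: c => /vertical_face_unique|split].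
  + by case=> _ _ _ e2; case: c => _ _ + _ _; rewrite e2 /= muln0.
- have /(vertical _ _ _ _ st pin)[_ _ _ e1] : face_label pi S' = ([::], S).
    exact/(contains_cons1 (nu := nu) (t := FaceTerm pi nu S' r)).
  by case: c => _ _; rewrite e1.
- have lab : face_label pi (Face 1 0 M1) = ([::], S) \/
      face_label pi (Face 0 1 M2) = ([::], S).
    exact/(contains_cons2 (nu := nu) (t := BaseTerm pi nu M1 M2)).
  right; exists M1, M2.
  by case: lab => /(vertical _ _ _ _ st pin)[epi eI enu e1] //; subst pi I nu.
Qed.

(** Whether the transformed ideal is a base ideal or is expanded further, exactly one term arises,
    with the value of a vertex term at (N, e); only the direction (w1, w2) of its second face
    depends on the case. *)
Lemma second_term : exists t2 w1 w2 Nw l, [/\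
  forall t, t = t2 <-> [/\ occurs t, contains_factor_of S t & term_path t <> [::]],
  value t2 = value (VertexTerm [:: (S, mu)] nu1 (Face 1 0 N) (Face w1 w2 Nw) N e),
  (0 < w2)%N, Nw = (w1 * N + w2 * e)%N &
  l <> ([::], S) /\ (l, ((w1 * nu1 + w2)%N, Nw)) \in denominator t2].
Proof.
have [geN gee sN] := newton_map_corner cS shF mu0 FX ne1.
have [[M1 [M2 bI]]|nbase] := pselect (exists M1 M2, base_ideal I1 M1 M2).
  have base M1' M2' : base_ideal I1 M1' M2' -> M1' = N /\ M2' = e.
    by move=> b'; exact: (base_ideal_exponents b' geN gee sN).
  have nex : ~ expanded [:: (S, mu)] I1 by case=> // -[]; exists M1, M2.
  have [e1 e2] := base _ _ bI; rewrite {}e1 {}e2 {M1 M2} in bI.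
  (* A base ideal has the horizontal second face (0, 1), with equation beta = e. *)
  exists (BaseTerm [:: (S, mu)] nu1 N e), 0%N, 1%N, e, ([:: (S, mu)], Face 0 1 e).
  split=> //.
  - move=> t; split=> [->|[ot ct pt]].
      split=> //; first exact: occurs_base second_stageP nex bI.
      apply/(contains_cons2 (pi := [:: (S, mu)]) (nu := nu1) (S1 := Face 1 0 N)
               (S2 := Face 0 1 e)) => //; by left.
    have [[S2 [a' [b' [_ ex _]]]]|[M1 [M2 [-> _ /base[-> ->]]]]] :=
      second_stage_term ot ct pt; last by [].
    by case: nex.
  - by rewrite value_base.
  - by rewrite mul0n mul1n.
  - split; first by case.
    by rewrite !inE /face_factor eqxx orbT.
have ex1 : expanded [:: (S, mu)] I1 by right.
have [S2 c2] : exists S2, consecutive I1 (Face 1 0 N) S2 N e.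
  apply: (next_face vertical_face) => //=; first by rewrite mul1n mul0n addn0.
  by move=> al be sab; rewrite mul1n mul0n addn0 => e1; apply: gee; rewrite -/N -e1.
have w20 : (0 < fq S2)%N by case: c2 => _ _ /=; rewrite muln0 mul1n.
exists (VertexTerm [:: (S, mu)] nu1 (Face 1 0 N) S2 N e), (fp S2), (fq S2), (fN S2).
exists ([:: (S, mu)], S2); split=> //.
- move=> t; split=> [->|[ot ct pt]].
    split=> //; first exact: occurs_vertex second_stageP ex1 c2.
    apply/(contains_cons2 (pi := [:: (S, mu)]) (nu := nu1) (S1 := Face 1 0 N)
             (S2 := S2)) => //; by left.
  have [[S2' [a' [b' [-> _ c2']]]]|[M1 [M2 [_ nex _]]]] :=
    second_stage_term ot ct pt.
  + by have [-> -> ->] := consecutive_right_unique c2' c2.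
  + by case: nex.
- by case: (S2).
- by have [_ _ e3] := consecutive_vertex c2; exact: esym e3.
- split; first by case.
  by rewrite !inE /face_factor /= (gtn_eqF w20) andbF eqxx.
Qed.

End SecondStage.

(** The common part for both axes. The second diagram is known only at its corner, so the last
    hypothesis ranges over every possible second face (w1, w2) there. *)
Lemma factor_cancels a b e F mu Sl Sr al bl ar br :
  shape I0 S a b e F -> mu != 0 ->
  (forall k, (k <= e)%N -> coef2 F (e - k) k = (('X - mu%:P) ^+ e)`_k) ->
  (forall mu', face_root I0 S mu' <-> mu' = mu) ->
  fp S = 1%N \/ fq S = 1%N -> (0 < nu0)%N ->
  root_number I0 S 1 -> (forall r, root_number I0 S r -> r = 1%N) ->
  consecutive I0 Sl S al bl -> consecutive I0 S Sr ar br ->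
  (forall w1 w2 Nw l t2,
    (0 < w2)%N -> Nw = (w1 * fN S + w2 * e)%N -> l <> ([::], S) -> occurs t2 ->
    (l, ((w1 * (fp S * nu0 + fq S) + w2)%N, Nw)) \in denominator t2 ->
    denominator_avoids I0 nu0 S
      (value (VertexTerm [::] nu0 Sl S al bl) + (value (VertexTerm [::] nu0 S Sr ar br) +
       (value (FaceTerm [::] nu0 S 1 : zeta_term R) +
        value (VertexTerm [:: (S, mu)] (fp S * nu0 + fq S)
                 (Face 1 0 (fN S)) (Face w1 w2 Nw) (fN S) e))))) ->
  factor_does_not_appear I0 nu0 S.
Proof.
move=> shF mu0 FX rootS axis nu00 r1 rr cl cr avoid.
have [t2 [w1 [w2 [Nw [l [t2P vt2 w20 eNw [lS lt2]]]]]]] :=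
  second_term shF mu0 FX rootS axis.
have [ot2 ct2 pt2] := (t2P t2).1 erefl.
apply: factor_does_not_appearP => //.
exists (first_terms Sl Sr al bl ar br ++ [:: t2]); split.
  split.
    rewrite cat_uniq (first_terms_uniq Sr ar br cl) /= orbF !andbT.
    by apply/negP => /(first_termsP cl cr r1 rr)[_ _ /pt2].
  move=> t; rewrite mem_cat; split.
    by case/orP => [/(first_termsP cl cr r1 rr)[]|] //; rewrite inE => /eqP->.
  move=> [ot ct]; have [pt|/eqP pt] := eqVneq (term_path t) [::].
    by apply/orP; left; apply/(first_termsP cl cr r1 rr).
  by apply/orP; right; rewrite inE; apply/eqP/t2P.
rewrite big_cat /= !big_cons !big_nil !addr0 vt2 -!addrA.
exact: (avoid _ _ _ _ _ w20 eNw lS ot2 lt2).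
Qed.

End Enumeration.

(** * Faces ending on a coordinate axis *)

Section Axes.
Variable R : realType.
Implicit Types (I : seq (series2 R)) (S : face).

(** The form b (p alpha + q beta) + beta is at least b N + b on the support: on the face because
    beta >= b, off it because the weight is at least N + 1. The bound extends to the diagram, while
    the form equals b N at the point of the face on the axis, so b = 0. *)
Lemma hits_x_axis_shape I S a b e F :
  shape I S a b e F -> is_face I S -> hits_x_axis I S -> b = 0%N.
Proof.
move=> [_ _ _ _ ends] FS [z [[dz ez] z2]].
have := @diagram_ge _ I (b * fp S) (b * fq S + 1) (b * fN S + b) _ z dz.
have -> : (b * fp S)%:R * z.1 + (b * fq S + 1)%:R * z.2 = (b * fN S)%:R :> R.
  by rewrite !natrM natrD natrM mulrDl mul1r z2 -!mulrA !mulr0 addr0 -ez z2 mulr0 !addr0.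
rewrite ler_nat => H; apply/eqP; rewrite -leqn0 -(leq_add2l (b * fN S)) addn0.
apply: H => al be sab; have := face_support_ge FS sab; rewrite leq_eqVlt => /orP[/eqP eN|lt].
  have [i [j [_ ebe _]]] := ends _ _ sab (esym eN).
  have bbe : (b <= be)%N by rewrite ebe leq_addr.
  by rewrite eN; lia.
have : (b * (fN S).+1 <= b * (fp S * al + fq S * be))%N by rewrite leq_mul2l lt orbT.
lia.
Qed.

Lemma hits_y_axis_shape I S a b e F :
  shape I S a b e F -> is_face I S -> hits_y_axis I S -> a = 0%N.
Proof.
move=> [_ _ _ _ ends] FS [z [[dz ez] z1]].
have := @diagram_ge _ I (a * fp S + 1) (a * fq S) (a * fN S + a) _ z dz.
have -> : (a * fp S + 1)%:R * z.1 + (a * fq S)%:R * z.2 = (a * fN S)%:R :> R.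
  by rewrite natrM natrM -ez z1 !mulr0 !add0r mulrA.
rewrite ler_nat => H; apply/eqP; rewrite -leqn0 -(leq_add2l (a * fN S)) addn0.
apply: H => al be sab; have := face_support_ge FS sab; rewrite leq_eqVlt => /orP[/eqP eN|lt].
  have [i [j [eal _ _]]] := ends _ _ sab (esym eN).
  have aal : (a <= al)%N by rewrite eal leq_addr.
  by rewrite eN; lia.
have : (a * (fN S).+1 <= a * (fp S * al + fq S * be))%N by rewrite leq_mul2l lt orbT.
lia.
Qed.

Lemma support_not_x_divides I be : in_support I 0 be -> ~ x_divides I.
Proof.
move=> [f fI nz] /(_ f (mem_ideal fI))[h fh]; move: nz.
have -> : f = xx R ^+ 1 * yy R ^+ 0 * h by rewrite expr0 mulr1 expr1.
by rewrite coef2_monomM eqxx.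
Qed.

End Axes.

Theorem proposition3p5 (R : realType) (I : seq (series2 R)) (nu : nat) (S : face) :
  nontrivial I ->
  (0 < nu)%N ->
  (~ x_divides I -> nu = 1%N) ->
  compact_face I S ->
  ~ dicritical I S ->
  root_number I S 1 ->
  (fp S = 1%N -> hits_x_axis I S -> factor_does_not_appear I nu S) /\
  (fq S = 1%N -> hits_y_axis I S -> factor_does_not_appear I nu S).
Proof.
move=> _ nu_gt0 nu1 cS ndS r1.
have [a [b [e [F [mu [shF [e0 mu0] FX rootS rr]]]]]] := one_root_face cS ndS r1.
have [FS p0 q0] := cS; have [eN _ sup _ ends] := shF.
have right_corner := shape_right_corner shF.
split=> [p1 /(hits_x_axis_shape shF FS) b0|q1 /(hits_y_axis_shape shF FS) a0].
- rewrite p1 b0 muln0 addn0 !mul1n in eN; rewrite p1 b0 add0n mul1n in sup.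
  rewrite b0 eN in right_corner.
  have [Sl cl] : exists Sl, consecutive I Sl S a e.
    apply: prev_face => //; first by rewrite p1 mul1n.
    by move=> al be sab /(ends _ _ sab)[i [j [-> _ _]]]; rewrite leq_addr.
  (* The endpoint (N, 0) carries a monomial, so the next face lies on the x-axis itself, with (N +
     1, 0) as a second point. *)
  have cr : consecutive I S (Face 0 1 0) (fN S) 0.
    have [F0 v v0] : [/\ is_face I (Face 0 1 0), face_set I S ((fN S)%:R, 0%:R) &
        face_set I (Face 0 1 0) ((fN S)%:R, 0%:R)].
      apply: (consecutive_intro (i := (fN S).+1) (j := 0) FS right_corner _ _ _
        right_corner) => //; first by rewrite p1 mul1n muln0 addn0.
      by case; lia.
    by split=> //=; rewrite p1.
  apply: (factor_cancels cS shF mu0 FX rootS _ nu_gt0 r1 rr cl cr); first by left.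
  move=> w1 w2 Nw l t2 w20 eNw lS ot2 lt2.
  have [_ eSl _] := consecutive_vertex cl; have [_ _ det _ _] := cl.
  rewrite p1 !mul1n in det lt2 *.
  (* The remaining factors belong to the two sides of the merged cone: the left neighbour of S and
     the second face at the corner of the transformed diagram. *)
  exists [:: face_factor [::] nu Sl; (l, ((w1 * (nu + fq S) + w2)%N, Nw))].
  exists (cone_value R nu a e (fp Sl) (fq Sl) w1 (fq S * w1 + w2)); split.
  + move=> f; rewrite !inE => /orP[]/eqP->; last by split; [exact: lS|exists t2].
    split; first by case=> eS; rewrite eS p1 mul1n ltnn in det.
    exists (VertexTerm [::] nu Sl S a e); split; last exact: mem_head.
    by apply: occurs_vertex (stage_init I nu) _ cl; left.
  + exact: is_polynomial_cone_value.
  + have total := @x_axis_total R [::] [:: (S, mu)] nu (fq S) a e (fN S)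
      (fp Sl) (fq Sl) (fN Sl) w1 w2 Nw nu_gt0 (esym eN) det w20 (esym eSl) eNw.
    have eSl' : Face (fp Sl) (fq Sl) (fN Sl) = Sl by case: (Sl).
    have eS' : Face 1 (fq S) (fN S) = S by case: (S) p1 => p q N /= ->.
    rewrite !big_cons big_nil mulr1 /= -total eSl' eS'.
    by rewrite -!addrA.
- rewrite q1 a0 muln0 add0n mul1n muln1 in eN; rewrite a0 in sup.
  rewrite q1 a0 add0n mul1n in right_corner; rewrite addnC in eN; rewrite addnC eN in sup.
  (* The upper endpoint (0, N) carries a monomial free of x. *)
  have nuE : nu = 1%N by apply/nu1/(support_not_x_divides sup).
  have [Sr cr] : exists Sr, consecutive I S Sr e b.
    apply: next_face => //; first by rewrite q1 mul1n.
    by move=> al be sab /(ends _ _ sab)[i [j [_ -> _]]]; rewrite leq_addr.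
  have cl : consecutive I (Face 1 0 0) S 0 (fN S).
    have [F0 v v0] : [/\ is_face I (Face 1 0 0), face_set I S (0%:R, (fN S)%:R) &
        face_set I (Face 1 0 0) (0%:R, (fN S)%:R)].
      apply: (consecutive_intro (i := 0) (j := (fN S).+1) FS sup _ _ _ sup) => //.
        by rewrite q1 mul1n muln0.
      by case; lia.
    by split=> //=; rewrite q1 muln0.
  apply: (factor_cancels cS shF mu0 FX rootS _ nu_gt0 r1 rr cl cr); first by right.
  move=> w1 w2 Nw l t2 w20 eNw lS ot2 lt2.
  have [_ _ eSr] := consecutive_vertex cr; have [_ _ det _ _] := cr.
  rewrite q1 muln1 in det; rewrite nuE q1 !muln1 in lt2 *.
  exists [:: (l, ((w1 * (fp S + 1) + w2)%N, Nw)); face_factor [::] 1 Sr].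
  exists (cone_value R 1 e b (fp S * w1 + w2) w1 (fp Sr) (fq Sr)); split.
  + move=> f; rewrite !inE => /orP[]/eqP->; first by split; [exact: lS|exists t2; rewrite -{1}nuE].
    split; first by case=> eS; rewrite eS q1 muln1 ltnn in det.
    exists (VertexTerm [::] 1 S Sr e b); split; last by rewrite !inE eqxx orbT.
    by apply: occurs_vertex (stage_init I 1) _ cr; left.
  + exact: is_polynomial_cone_value.
  + have total := @y_axis_total R [::] [:: (S, mu)] (fp S) b e (fN S)
      (fp Sr) (fq Sr) (fN Sr) w1 w2 Nw (esym eN) det w20 (esym eSr) eNw.
    have eSr' : Face (fp Sr) (fq Sr) (fN Sr) = Sr by case: (Sr).
    have eS' : Face (fp S) 1 (fN S) = S by case: (S) q1 => p q N /= ->.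
    rewrite !big_cons big_nil mulr1 /= muln1 -total eSr' eS'.
    by congr (_ * _); rewrite addrCA !addrA.
Qed.
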